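(* Let $d\ge1$, let $\Lambda\subset\mathbb{R}^d$ be a lattice, let $0<s<d$, and let $$\mathcal{D}=B(0,r_d),\qquad r_d=\left(\frac{d\,|\Lambda|^{-1}}{\omega_{d-1}}\right)^{1/d}.$$ Then $|\mathcal{D}||\Lambda|=1$ and $$\frac{\pi^{s-\frac d2}\,\Gamma\left(\frac{d-s}2\right)}{\Gamma\left(\frac s2\right)|\Lambda|^{1-\frac sd}}\,I_\nu^{\mathcal{D}}(d-s)=d\left[2\pi\left(\frac{d}{\omega_{d-1}}\right)^{1/d}\right]^s\int_0^\infty\frac{J_{d/2}^2(t)}{t^{1+s}}\,dt,$$ where $$\int_0^\infty\frac{J_{d/2}^2(t)}{t^{1+s}}\,dt=\frac{\Gamma\left(\frac{d-s}2\right)}{2^{d+1}\Gamma\left(\frac d2+1\right)\Gamma\left(\frac s2+1\right)}\;{}_2F_1\left(\frac{d-s}2,\frac{d+1}2;d+1;1\right)$$ $$=\frac{\Gamma\left(\frac{d-s}2\right)\Gamma(d+1)\Gamma\left(\frac{s+1}2\right)}{2^{d+1}\Gamma\left(\frac d2+1\right)\Gamma\left(\frac s2+1\right)\Gamma\left(\frac{d+s}2+1\right)\Gamma\left(\frac{d+1}2\right)}.$$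
   Context: A lattice is $\Lambda=A\mathbb{Z}^d$ with $A$ a nonsingular real $d\times d$ matrix, with co-volume $|\Lambda|=|\det A|$ and dual lattice $\Lambda^*=(A^t)^{-1}\mathbb{Z}^d$. For a measurable set $\mathcal{D}\subset\mathbb{R}^d$, $|\mathcal{D}|$ is its Lebesgue measure; $B(0,r)$ is the open Euclidean ball of radius $r$ centered at the origin. $\omega_{d-1}=d\,\pi^{d/2}/\Gamma\left(\frac d2+1\right)$ is the surface measure of the unit sphere $\mathbb{S}^{d-1}\subset\mathbb{R}^d$. $J_{d/2}$ is the Bessel function of the first kind of order $d/2$, and ${}_2F_1$ is the Gauss hypergeometric function. For $0<t<d$, $$I_\nu^{\mathcal{D}}(t)=\int_{\mathcal{D}\times\mathcal{D}}\frac{1}{|x-y|^t}\,d\nu(x)\,d\nu(y),$$ where $\nu$ is the multiple of Lebesgue measure on $\mathbb{R}^d$ such that a fundamental domain of $\Lambda^*$ has $\nu$-measure $1$ (i.e. $\nu=|\Lambda|$ times Lebesgue measure). *)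

(* Defs.v *)
From HB Require Import structures.
From mathcomp Require Import all_boot all_order all_algebra.
From mathcomp Require Import all_classical all_reals all_analysis.

Set Implicit Arguments.
Unset Strict Implicit.
Unset Printing Implicit Defensive.

Import Order.TTheory GRing.Theory Num.Theory.
Import numFieldNormedType.Exports.

Local Open Scope classical_set_scope.
Local Open Scope ring_scope.

Section euclidean.
Context {R : realType}.

Definition edist (d : nat) (x y : d.-tuple R) : R :=
  Num.sqrt (\sum_(i < d) (tnth x i - tnth y i) ^+ 2).

Definition eball (d : nat) (x : d.-tuple R) (r : R) : set (d.-tuple R) :=
  [set y | edist x y < r].

Definition origin (d : nat) : d.-tuple R := [tuple 0 | i < d].

End euclidean.

Section lebesgue_tuple.
Context {R : realType}.
Local Open Scope ereal_scope.
Local Notation T := (measurableTypeR R).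
Local Notation mu := (@lebesgue_measure R).

(* Lebesgue measure on the Borel sets of R^d, as the d-fold product of the
   Lebesgue measure on R; lebesgue_tuple_box below gives its value on boxes. *)
Fixpoint lebesgue_tuple (d : nat) : set (d.-tuple T) -> \bar R :=
  match d with
  | 0 => \d_ [tuple]
  | n.+1 => pushforward (mu \x @lebesgue_tuple n)
              (fun p : T * n.-tuple T => [tuple of p.1 :: p.2])
  end.

Let cons_tuple n (p : T * n.-tuple T) : n.+1.-tuple T := [tuple of p.1 :: p.2].

Let measurable_cons_tuple n : measurable_fun setT (@cons_tuple n).
Proof. by apply: measurable_cons. Qed.

Let uncons_tuple n (v : n.+1.-tuple T) : T * n.-tuple T :=
  (thead v, [tuple of behead v]).

Let cons_tupleK n : cancel (@cons_tuple n) (@uncons_tuple n).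
Proof. by move=> [x v]; congr pair; apply/val_inj. Qed.

Let measurable_uncons_tuple n : measurable_fun setT (@uncons_tuple n).
Proof.
apply/measurable_fun_pairP; split; last exact: measurable_behead.
exact: measurable_tnth.
Qed.

Let cons_sigma_finite n (m : {sigma_finite_measure set (n.-tuple T) -> \bar R}) :
  sigma_finite setT (pushforward (mu \x m) (@cons_tuple n)).
Proof.
have /sigma_finiteP[F [TF ndF Foo]] := sigma_finiteT mu.
have /sigma_finiteP[G [TG ndG Goo]] := sigma_finiteT m.
exists (fun k => @uncons_tuple n @^-1` (F k `*` G k)).
  apply/seteqP; split => // v _ /=.
  have [i _ Fi] : (\bigcup_i F i) (thead v) by rewrite -TF.
  have [j _ Gj] : (\bigcup_j G j) [tuple of behead v] by rewrite -TG.
  exists (maxn i j) => //; split => /=.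
    by move: Fi; exact/subsetPset/ndF/leq_maxl.
  by move: Gj; exact/subsetPset/ndG/leq_maxr.
move=> k; have [mF Fk] := Foo k; have [mG Gk] := Goo k; split.
  by rewrite -[X in measurable X]setTI; apply: measurable_uncons_tuple => //;
    exact: measurableX.
rewrite /pushforward -comp_preimage.
rewrite (_ : _ \o _ = idfun); last by apply/funext => p; exact: cons_tupleK.
by rewrite preimage_id product_measure1E// lte_mul_pinfty// ge0_fin_numE.
Qed.

Let lebesgue_tuple_spec d : exists m :
  {sigma_finite_measure set (d.-tuple T) -> \bar R}, @lebesgue_tuple d = m.
Proof.
elim: d => [|d [m mE]]; first by exists (\d_ [tuple]).
pose M : {measure set (d.+1.-tuple T) -> \bar R} :=
  measure_function_pushforward__canonical__measure_function_Measure (mu \x m)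
    (@measurable_cons_tuple d).
have Msf : sigma_finite setT M := cons_sigma_finite m.
pose H1 := isSFinite.Build _ _ _ _ (sfinite_measure_sigma_finite Msf).
pose H2 := isSigmaFinite.Build _ _ _ _ Msf.
pose M' := HB.pack_for {sigma_finite_measure set (d.+1.-tuple T) -> \bar R}
  (Measure.sort M) H1 H2.
by exists M'; rewrite /= mE.
Qed.

Section instances.
Variable d : nat.

Let lebesgue_tuple0 : @lebesgue_tuple d set0 = 0.
Proof. by have [m ->] := lebesgue_tuple_spec d; rewrite measure0. Qed.

Let lebesgue_tuple_ge0 A : 0 <= @lebesgue_tuple d A.
Proof. by have [m ->] := lebesgue_tuple_spec d; exact: measure_ge0. Qed.

Let lebesgue_tuple_sigma_additive : semi_sigma_additive (@lebesgue_tuple d).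
Proof.
by have [m ->] := lebesgue_tuple_spec d; exact: measure_semi_sigma_additive.
Qed.

HB.instance Definition _ := isMeasure.Build _ _ _ (@lebesgue_tuple d)
  lebesgue_tuple0 lebesgue_tuple_ge0 lebesgue_tuple_sigma_additive.

Let lebesgue_tuple_sigma_finite : sigma_finite setT (@lebesgue_tuple d).
Proof. by have [m ->] := lebesgue_tuple_spec d; exact: sigma_finiteT. Qed.

HB.instance Definition _ := Measure_isSigmaFinite.Build _ _ _
  (@lebesgue_tuple d) lebesgue_tuple_sigma_finite.

End instances.

Let measurable_box d (A : 'I_d -> set T) : (forall i, measurable (A i)) ->
  measurable [set x : d.-tuple T | forall i, A i (tnth x i)].
Proof.
move=> mA; rewrite (_ : mkset _ =
    \bigcap_(i in setT) ((fun x : d.-tuple T => tnth x i) @^-1` A i)); last first.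
  by apply/seteqP; split => [x h i _|x h i]; exact: h.
apply: fin_bigcap_measurable => // i _.
by rewrite -[X in measurable X]setTI; exact: measurable_tnth.
Qed.

Lemma lebesgue_tuple_box d (A : 'I_d -> set T) : (forall i, measurable (A i)) ->
  lebesgue_tuple [set x : d.-tuple T | forall i, A i (tnth x i)] =
  \prod_(i < d) mu (A i).
Proof.
elim: d A => [A _|d IH A mA].
  by rewrite big_ord0 /= diracE mem_set// => -[].
rewrite big_ord_recl -(IH (fun i => A (lift ord0 i)))// /= /pushforward.
rewrite -product_measure1E//; last first.
  exact: (@measurable_box d (fun i => A (lift ord0 i))).
congr (_ _); apply/seteqP; split => -[x v] /=.
  move=> h; split; first by have := h ord0.
  by move=> i; have := h (lift ord0 i); rewrite tnthS.
move=> [h0 h] i; have [j ->|->] := unliftP ord0 i; last exact: h0.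
by rewrite tnthS; exact: h.
Qed.

End lebesgue_tuple.

Section lattice.
Context {R : realType} (d : nat).

(* The lattice A Z^d. *)
Definition int_span (A : 'M[R]_d) : set (d.-tuple R) :=
  [set x | exists z : 'I_d -> int,
    forall i, tnth x i = \sum_(j < d) A i j * (z j)%:~R].

Definition is_lattice (L : set (d.-tuple R)) : Prop :=
  exists2 A : 'M[R]_d, A \in unitmx & L = int_span A.

(* |det A| for some basis matrix A of L; independent of A by covolumeE. *)
Definition covolume (L : set (d.-tuple R)) : R :=
  `|\det (xget 0 [set A : 'M[R]_d | A \in unitmx /\ L = int_span A])|.

Let int_span_mul (A B : 'M[R]_d) : int_span B `<=` int_span A ->
  exists U : 'M[int]_d, B = A *m map_mx intr U.
Proof.
move=> BA.
have /choice[u uE] (k : 'I_d) : exists z : 'I_d -> int,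
    forall i, B i k = \sum_(j < d) A i j * (z j)%:~R.
  have /BA[z zE] : int_span B [tuple B i k | i < d].
    exists (fun j => (j == k)%:Z) => i; rewrite tnth_mktuple (bigD1 k)//=.
    rewrite eqxx mulr1 big1 ?addr0// => j /negPf ->.
    by rewrite mulr0.
  by exists z => i; rewrite -zE tnth_mktuple.
exists (\matrix_(j, k) u k j); apply/matrixP => i k.
by rewrite uE mxE; apply: eq_bigr => j _; rewrite !mxE.
Qed.

Lemma covolumeE (A : 'M[R]_d) : A \in unitmx ->
  covolume (int_span A) = `|\det A|.
Proof.
move=> Au; rewrite /covolume; case: xgetP => [B _ [Bu AB]|/(_ A)]; last first.
  by move=> h; exfalso; exact: h.
have [U BE] : exists U : 'M[int]_d, B = A *m map_mx intr U.
  by apply: int_span_mul; rewrite AB.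
have [V AE] : exists V : 'M[int]_d, A = B *m map_mx intr V.
  by apply: int_span_mul; rewrite AB.
have dA : `|\det A| != 0 by rewrite normr_eq0 -unitfE -unitmxE.
have dBE : `|\det B| = `|\det A| * `|\det U|%:~R.
  by rewrite {1}BE det_mulmx det_map_mx normrM intr_norm.
have dAE : `|\det A| = `|\det B| * `|\det V|%:~R.
  by rewrite {1}AE det_mulmx det_map_mx normrM intr_norm.
have : `|\det U| * `|\det V| = 1.
  apply: (@intr_inj R); apply: (mulfI dA).
  by rewrite intrM mulrA -dBE -dAE mulr1.
rewrite -!abszE -PoszM => -[/eqP]; rewrite muln_eq1 => /andP[/eqP U1 _].
by rewrite dBE -abszE U1 mulr1.
Qed.

Lemma covolume_gt0 (L : set (d.-tuple R)) : is_lattice L -> 0 < covolume L.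
Proof.
by move=> [A Au ->]; rewrite covolumeE// normr_gt0 -unitfE -unitmxE.
Qed.

End lattice.

Section special_functions.
Context {R : realType}.
Implicit Types a b c nu s t x : R.

(* Only meaningful for a > 0. *)
Definition Gamma a : R :=
  (\int[@lebesgue_measure R]_(t in `]0, +oo[) (t `^ (a - 1) * expR (- t)))%R.

(* Power series of the Bessel function of the first kind of order nu, only
   meaningful for nu > -1 and t >= 0. *)
Definition besselJ nu t : R :=
  limn (series (fun m => (-1) ^+ m / (m`!%:R * Gamma (m%:R + nu + 1)) *
                         (t / 2) `^ (2 * m%:R + nu))).

Definition rising a (n : nat) : R := \prod_(i < n) (a + i%:R).

(* The Gauss hypergeometric function 2F1(a, b; c; x). *)
Definition hyp2F1 a b c x : R :=
  limn (series (fun n => rising a n * rising b n / rising c n / n`!%:R * x ^+ n)).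

End special_functions.

Section energy.
Context {R : realType}.
Local Open Scope ereal_scope.

(* omega_{d-1}, the surface measure of the unit sphere of R^d. *)
Definition sphere_area (d : nat) : R :=
  (d%:R * pi `^ (d%:R / 2) / Gamma (d%:R / 2 + 1))%R.

(* The multiple of Lebesgue measure giving mass 1 to a fundamental domain of
   the dual lattice, whose Lebesgue measure is 1 / covolume L.  The outer
   absolute value only serves to build a {nonneg R}. *)
Definition lattice_measure (d : nat) (L : set (d.-tuple R)) :
    set (d.-tuple (measurableTypeR R)) -> \bar R :=
  mscale (`|covolume L|%:nng)%R (@lebesgue_tuple R d).

HB.instance Definition _ d L := Measure.on (@lattice_measure d L).

Let lattice_measure_sigma_finite d L :
  sigma_finite setT (@lattice_measure d L).
Proof.
have [F TF Foo] := sigma_finiteT (@lebesgue_tuple R d).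
exists F => // k; have [mF Fk] := Foo k; split => //.
by rewrite /lattice_measure /mscale lte_mul_pinfty.
Qed.

HB.instance Definition _ d L := Measure_isSigmaFinite.Build _ _ _
  (@lattice_measure d L) (@lattice_measure_sigma_finite d L).

(* The kernel is real-valued and takes the value 0 on the diagonal, a null set
   when d > 0. *)
Definition riesz_energy (d : nat) (nu : set (d.-tuple (measurableTypeR R)) -> \bar R)
    (D : set (d.-tuple R)) (t : R) : \bar R :=
  \int[nu \x nu]_(z in D `*` D) (1 / edist z.1 z.2 `^ t)%R%:E.

End energy.

(* Main.v *)
(* Everything is reduced to Gamma integrals by Tonelli's theorem.

   Bessel integral: t^(-2-s) is a mixture of the Gaussians exp(-u t^2).  By
   Vandermonde's identity the square of J_(d/2) has an explicit alternating
   power series, and integrating it term by term gives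
     int_0^oo exp(-u t^2) t J_(d/2)(t)^2 dt
       = const * u^(-d/2-1) int_0^1 exp(-x/u) (x(1-x))^((d-1)/2) dx,
   a positive integrand, so that the integrals in u and x can be exchanged; they
   are a Gamma and a Beta integral.

   Energy: by translation and rotation invariance the energy of a ball is the
   integral of |z|^(s-d) against the volume of the intersection of two balls with
   centres at distance |z|.  In polar coordinates this is again a Beta integral.

   The value of 2F1 at 1 is Gauss's summation theorem, obtained from Euler's
   integral by expanding (1-x)^(-a) in powers of x. *)

From HB Require Import structures.
Require Import Defs.
From mathcomp Require Import all_boot all_order all_algebra.
From mathcomp Require Import all_classical all_reals all_analysis.
From mathcomp Require Import measurable_realfun ring lra.

Import Order.TTheory GRing.Theory Num.Theory.
Import numFieldNormedType.Exports.

Local Open Scope classical_set_scope.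
Local Open Scope ring_scope.

(** * Changes of variables on the real line *)

Section substitution.
Context {R : realType}.
Local Notation mu := (@lebesgue_measure R).
Local Notation T := (measurableTypeR R).
Implicit Types F : T -> \bar R.
Local Open Scope ereal_scope.

(** The obstacle is that the Bessel series alternates and that, undamped, its terms are not
    integrable. The Gaussian makes the integrals of the terms absolutely summable for each u > 0,
    and the resulting series is recognised as the termwise integral of a second, positive integrand.
    From there on all integrands are non-negative and integrals live in the extended reals, so
    integrability is not an issue. Multiplicative substitutions reduce to shifts and scalings
    through x = e^y.

    No surface measure is introduced: polar coordinates are stated for the squared norm, and the
    sphere area enters only through its Gamma formula. Rotation invariance is proved only for
    functions of |v|^2 and <v, z>, one plane at a time, so no orthogonal matrix appears. Both sides
    meet in the closed form Gamma((d-s)/2) Gamma((s+1)/2) / (2 sqrt(pi) Gamma(s/2+1)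
    Gamma((d+s)/2+1)) of the Bessel integral; what remains is algebra with the functional equation
    of Gamma and the duplication formula, which is needed only at integers. *)

Lemma ge0_integralN F : measurable_fun setT F -> (forall x, 0 <= F x) ->
  \int[mu]_x F (- x)%R = \int[mu]_x F x.
Proof.
move=> mF F0.
rewrite -[LHS](@ge0_integral_pushforward _ _ T T R (-%R : T -> T) _ mu setT F)//=.
by apply: eq_measure_integral => A mA _; exact: lebesgue_measureN.
Qed.

(** [a] times the image of Lebesgue measure under the map agrees with Lebesgue measure on half-open
    intervals, hence everywhere by uniqueness. *)
Lemma ge0_integral_affine (a b : R) F : (0 < a)%R ->
  measurable_fun setT F -> (forall x, 0 <= F x) ->
  \int[mu]_x F (a * x + b)%R = (a^-1)%:E * \int[mu]_x F x.
Proof.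
move=> a0 mF F0.
have mphi : measurable_fun setT (fun x : measurableTypeR R => (a * x + b)%R : measurableTypeR R).
  by apply: measurable_funD => //; exact: measurable_funM.
have ai0 : (0 <= a)%R by exact: ltW.
rewrite -[LHS](@ge0_integral_pushforward _ _ T T R (fun x : T => a * x + b)%R mphi mu setT F)//=.
have aE : a = (NngNum ai0)%:num by [].
pose m := pushforward mu (fun x : measurableTypeR R => a * x + b : measurableTypeR R)%R.
pose m' : {measure set (measurableTypeR R) -> \bar R} :=
  measure_function_pushforward__canonical__measure_function_Measure mu mphi.
have h A : measurable A -> mu A = mscale (NngNum ai0) m' A.
  apply: lebesgue_measure_unique => _ [[u v]] _ <-.
  rewrite /= /mscale /= /pushforward/=.
  rewrite (_ : _ @^-1` _ = `](a^-1 * (u - b)), (a^-1 * (v - b))]%classic)%R.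
    rewrite !lebesgue_measure_itv/= !lte_fin ltr_pM2l ?invr_gt0// ltrD2r.
    case: ifPn => _; last by rewrite mule0.
    by rewrite -!EFinB -EFinM -mulrBr mulrA divff ?gt_eqF// mul1r; congr EFin; lra.
  apply/seteqP; split => x /=; rewrite !in_itv/= => /andP[h1 h2]; apply/andP; split.
  - by rewrite ltr_pdivrMl//; lra.
  - by rewrite ler_pdivlMl//; lra.
  - by rewrite ltr_pdivrMl// in h1; lra.
  - by rewrite ler_pdivlMl// in h2; lra.
rewrite [in RHS](eq_measure_integral (mscale (NngNum ai0) m'))/=; last by move=> A mA _; exact: h.
rewrite ge0_integral_mscale//= muleA -EFinM mulVf ?gt_eqF// mul1e.
by [].
Qed.

Lemma ge0_integral_shift (b : R) F :
  measurable_fun setT F -> (forall x, 0 <= F x) ->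
  \int[mu]_x F (x + b)%R = \int[mu]_x F x.
Proof.
move=> mF F0; rewrite -[RHS]mul1e -[1]/(1%:E) -invr1 -(@ge0_integral_affine _ b)//.
by under [RHS]eq_integral do rewrite mul1r.
Qed.

Lemma ge0_integral_scale (a : R) F : (0 < a)%R ->
  measurable_fun setT F -> (forall x, 0 <= F x) ->
  \int[mu]_x F (a * x)%R = (a^-1)%:E * \int[mu]_x F x.
Proof.
move=> a0 mF F0; rewrite -(@ge0_integral_affine _ 0)//.
by under [RHS]eq_integral do rewrite addr0.
Qed.

End substitution.

Section density.
Context (d : measure_display) (T : measurableType d) (R : realType).
Context (mu nu : {measure set T -> \bar R}) (g : T -> R).
Hypothesis mg : measurable_fun setT g.
Hypothesis g0 : forall x, 0 <= g x.
Hypothesis nuE : forall A, measurable A -> nu A = (\int[mu]_(x in A) (g x)%:E)%E.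
Local Open Scope ereal_scope.
Import HBNNSimple.

(** For simple functions this is [nuE]; monotone convergence carries it over on both sides because
    the density is non-negative. *)
Lemma ge0_integral_density (f : T -> \bar R) :
  measurable_fun setT f -> (forall x, 0 <= f x) ->
  \int[nu]_x f x = \int[mu]_x (f x * (g x)%:E).
Proof.
move=> mf f0.
pose f_ := nnsfun_approx measurableT mf.
transitivity (limn (fun n => \int[nu]_x (f_ n x)%:E)).
  rewrite -monotone_convergence//.
  - apply: eq_integral => y _; apply/esym/cvg_lim => //.
    exact: cvg_nnsfun_approx.
  - by move=> n; exact/measurable_EFinP/measurable_funP.
  - by move=> n y _; rewrite lee_fin.
  - by move=> y _ m n mn; rewrite lee_fin; exact/lefP/nd_nnsfun_approx.
transitivity (limn (fun n => \int[mu]_x ((f_ n x)%:E * (g x)%:E))); last first.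
  rewrite -monotone_convergence//.
  - apply: eq_integral => y _; apply/cvg_lim => //.
    by apply: cvgeMr => //; exact: cvg_nnsfun_approx.
  - move=> n; apply: emeasurable_funM; last exact/measurable_EFinP.
    exact/measurable_EFinP/measurable_funP.
  - by move=> n y _; rewrite mule_ge0// lee_fin.
  - move=> y _ m n mn; apply: lee_wpmul2r; rewrite lee_fin//.
    exact/lefP/nd_nnsfun_approx.
congr (limn _); apply/funext => n.
transitivity (\sum_(k \in range (f_ n))
    \int[nu]_x (k * \1_(f_ n @^-1` [set k]) x)%:E).
  under eq_integral do rewrite fimfunE -fsumEFin//.
  rewrite ge0_integral_fsum//.
  - by move=> y; exact/measurable_EFinP/measurable_funM.
  - by move=> y x _; rewrite nnfun_muleindic_ge0.
transitivity (\sum_(k \in range (f_ n))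
    \int[mu]_x ((k * \1_(f_ n @^-1` [set k]) x)%:E * (g x)%:E)); last first.
  rewrite -ge0_integral_fsum//; last 2 first.
  - move=> y; apply: emeasurable_funM; last exact/measurable_EFinP.
    exact/measurable_EFinP/measurable_funM.
  - by move=> y x _; rewrite mule_ge0// ?nnfun_muleindic_ge0// lee_fin.
  apply: eq_integral => x _; rewrite [in RHS]fimfunE -fsumEFin//.
  rewrite ge0_mule_fsuml// => r.
  by rewrite nnfun_muleindic_ge0.
apply: eq_fsbigr => r _.
rewrite integralZl_indic_nnsfun// integral_indic//= setIT.
have mA : measurable (f_ n @^-1` [set r]).
  by rewrite -[X in measurable X]setTI; exact: measurable_funP.
under [RHS]eq_integral => x _ do rewrite EFinM -muleA.
have [r0|r0] := leP 0%R r; last first.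
  rewrite preimage_nnfun0// measure0 mule0; under eq_integral do rewrite indic0 mul0e mule0.
  by rewrite integral0.
rewrite ge0_integralZl_EFin//; last 2 first.
- by move=> x _; rewrite mule_ge0// lee_fin.
- by apply: emeasurable_funM; exact/measurable_EFinP.
rewrite nuE// integral_mkcond epatch_indic; congr (_ * _); apply: eq_integral => x _.
by rewrite muleC.
Qed.
End density.

Section exp_substitution.
Context {R : realType}.
Local Notation mu := (@lebesgue_measure R).
Local Notation T := (measurableTypeR R).
Local Open Scope ereal_scope.

Lemma integral_expRN (a : R) :
  \int[mu]_(x in `[a, +oo[) (expR (- x))%:E = (expR (- a))%:E.
Proof.
rewrite (@ge0_continuous_FTC2y _ _ (fun x => - expR (- x))%R _ 0%R).
- by rewrite EFinN oppeK add0e.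
- by move=> x _; exact: expR_ge0.
- apply: continuous_subspaceT => x; apply: continuous_comp; last exact: continuous_expR.
  exact: continuousN.
- rewrite -[X in _ --> X]oppr0; apply: cvgN; exact: cvgr_expR.
- by move=> x _; exact: ex_derive.
- apply: cvg_at_right_filter; apply: cvgN; apply: continuous_comp; last exact: continuous_expR.
  exact: continuousN.
- move=> x _; rewrite derive1E derive_val.
  by rewrite /GRing.scale/=; lra.
Qed.

(** Packaged as a measure so that its image under [expR] can be compared with Lebesgue measure on
    intervals. *)
Definition exp_density (A : set T) : \bar R := \int[mu]_(x in A) (expR x)%:E.

Let exp_density0 : exp_density set0 = 0.
Proof. exact: integral_set0. Qed.

Let exp_density_ge0 A : 0 <= exp_density A.
Proof. by apply: integral_ge0 => x _; rewrite lee_fin expR_ge0. Qed.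

Let exp_density_sigma_additive : semi_sigma_additive exp_density.
Proof.
move=> A mA tA mUA; rewrite /exp_density ge0_integral_bigcup//=.
  by apply: is_cvg_ereal_nneg_natsum_cond => n _ _; exact: exp_density_ge0.
exact/measurable_EFinP/measurable_funTS.
Qed.

HB.instance Definition _ := isMeasure.Build _ _ _ exp_density
  exp_density0 exp_density_ge0 exp_density_sigma_additive.

Let exp_density_Ny (c : R) : exp_density (expR @^-1` `]-oo, c]) = (Num.max c 0)%:E.
Proof.
rewrite /exp_density; have [c0|c0] := leP c 0%R.
  rewrite (_ : _ @^-1` _ = set0) ?integral_set0 ?max_r//.
  apply/seteqP; split => // x /=; rewrite in_itv/= leNgt.
  by rewrite (le_lt_trans c0)// expR_gt0.
rewrite (_ : _ @^-1` _ = `]-oo, ln c]%classic); last first.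
  apply/seteqP; split => x /=; rewrite !in_itv/= => xc.
    by rewrite -ler_expR lnK// posrE.
  by rewrite -[leRHS](lnK c0) ler_expR.
rewrite -[RHS]/(c%:E) -{2}(lnK c0) -{2}[ln c]opprK -integral_expRN.
rewrite [LHS]integral_mkcond [RHS]integral_mkcond/=.
rewrite -[LHS]ge0_integralN//.
- apply: eq_integral => x _ /=; rewrite !patchE !mem_setE/= !in_itv/= andbT.
  by rewrite lerNl.
- by apply/(measurable_restrictT _ _).1 => //; apply/measurable_EFinP/measurable_funTS.
- by move=> x; rewrite patchE; case: ifP => // _; rewrite lee_fin expR_ge0.
Qed.

Let mexpR : measurable_fun setT (expR : T -> T).
Proof. exact: measurable_expR. Qed.

Let exp_push : {measure set T -> \bar R} :=
  measure_function_pushforward__canonical__measure_function_Measure exp_density mexpR.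

Let mNy0 : measurable (`]-oo, 0%R] : set T).
Proof. exact: measurable_itv. Qed.

(* The image of exp(x) dx under exp is Lebesgue measure on the positive half-line;
   the other half-line is added so that the two measures agree on all intervals. *)
Let lebesgue_expE A : measurable A ->
  mu A = measure_add exp_push (mrestr mu mNy0) A.
Proof.
apply: lebesgue_measure_unique => _ [[a b]] _ <-.
apply: (etrans _ (esym (measure_addE exp_push (mrestr mu mNy0) _))).
rewrite -[RHS]/(exp_push `]a, b]%classic + mu (`]a, b]%classic `&` `]-oo, 0%R])).
rewrite -[LHS]/(mu `]a, b]%classic).
have [ba|ab] := leP b a.
  by rewrite set_itv_ge ?bnd_simp -?leNgt// set0I !measure0 adde0.
have mitv c : measurable (`]-oo, c] : set T) by exact: measurable_itv.
have -> : exp_push `]a, b]%classic = (Num.max b 0 - Num.max a 0)%:E.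
  rewrite (_ : `]a, b]%classic = `]-oo, b] `\` `]-oo, a])%classic; last first.
    apply/seteqP; split => x /=; rewrite !in_itv/=.
      by move=> /andP[ax ->]; split => //; apply/negP; rewrite -ltNge.
    by move=> [-> /negP]; rewrite -ltNge => ->.
  rewrite measureD//; last first.
    by rewrite /= /pushforward exp_density_Ny ltry.
  rewrite (_ : _ `&` _ = `]-oo, a]%classic); last first.
    apply/seteqP; split => x /=; rewrite !in_itv/=; first by case.
    by move=> xa; split => //; rewrite (le_trans xa)// ltW.
  by rewrite /= /pushforward !exp_density_Ny.
rewrite (_ : _ `&` _ = `]a, (Num.min b 0)%R]%classic); last first.
  apply/seteqP; split => x /=; rewrite !in_itv/= le_min.
    by move=> [/andP[-> ->] ->].
  by move=> /and3P[-> -> ->].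
rewrite !lebesgue_measure_itv/= !lte_fin ab -!EFinB.
have [b0|b0] := leP b 0%R; have [a0|a0] := leP a 0%R.
- by rewrite ab -EFinD subrr add0r.
- by exfalso; move: (lt_trans (lt_le_trans ab b0) a0); rewrite ltxx.
- case: ifPn => [_|]; first by rewrite -EFinD; congr EFin; lra.
  by rewrite -leNgt => a0'; rewrite adde0; congr EFin; move: a0 a0'; lra.
- by rewrite ltNge (ltW a0)/= adde0.
Qed.

(** In the logarithmic coordinate, multiplication by c is a shift and raising to the power p a
    scaling, so the affine substitutions suffice afterwards. *)
Lemma ge0_integral_expR (F : T -> \bar R) :
  measurable_fun setT F -> (forall x, 0 <= F x) ->
  \int[mu]_(x in `]0%R, +oo[) F x = \int[mu]_x (F (expR x) * (expR x)%:E).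
Proof.
move=> mF F0.
rewrite -(@ge0_integral_density _ _ _ mu exp_density expR _ (@expR_ge0 R) _ (F \o (expR : T ->
    T)))//; last 2 first.
- exact: (measurableT_comp mF mexpR).
- by move=> x; exact: F0.
rewrite (_ : setT = (expR : T -> T) @^-1` `]0%R, +oo[); last first.
  by apply/seteqP; split => x//= _; rewrite in_itv/= andbT expR_gt0.
rewrite -[RHS](@ge0_integral_pushforward _ _ T T R (expR : T -> T) mexpR exp_density)//; last first.
  exact: measurable_funTS.
apply: eq_measure_integral => A mA A0.
apply: (etrans (lebesgue_expE _ mA)).
apply: (etrans (measure_addE exp_push (mrestr mu mNy0) _)).
rewrite [X in _ + X](_ : _ = mu (A `&` `]-oo, 0%R]))//.
rewrite (_ : A `&` _ = set0) ?measure0 ?adde0//.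
by apply/seteqP; split => // x [/A0]; rewrite /= !in_itv/= andbT leNgt => ->.
Qed.

End exp_substitution.

(** * The powers of the positive part *)

Section power_kernel.
Context {R : realType}.
Local Notation mu := (@lebesgue_measure R).
Local Notation T := (measurableTypeR R).
Implicit Types (F : T -> \bar R) (a b c p : R).

(* Extending x^(a-1) by 0 to the left of the origin lets truncations (a = 1),
   Gamma and Beta integrals and Riesz kernels all be integrals over R. *)
Definition pker a (x : T) : R := if 0 < x then x `^ (a - 1) else 0.

Lemma pker_ge0 a x : 0 <= pker a x.
Proof. by rewrite /pker; case: ifP => // _; exact: powR_ge0. Qed.

Lemma measurable_pker a : measurable_fun setT (pker a).
Proof.
by apply: measurable_fun_ifT => //; apply: measurable_fun_ltr.
Qed.

Lemma pkerM a b x : 0 < x -> pker (a + b) x = x `^ b * pker a x.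
Proof.
move=> x0; rewrite /pker x0 -powRD; last by rewrite (gt_eqF x0) implybT.
by congr (_ `^ _); lra.
Qed.

(** The Jacobian e^x absorbs the -1 in the exponent of [pker]. *)
Lemma pker_expR a x : pker a (expR x) * expR x = expR (a * x).
Proof.
rewrite /pker expR_gt0 -expRM -expRD.
by congr expR; lra.
Qed.
End power_kernel.

(** * Tactics for measurability and rational identities *)

Ltac meas_step :=
  match goal with
  | |- measurable_fun _ _ => first
      [ assumption | exact: measurable_cst | exact: measurable_id
      | exact: measurable_fst | exact: measurable_snd ]
  | |- measurable_fun _ (fun x => (@?f x * @?g x)%E) => apply: (@emeasurable_funM _ _ _ _ f g)
  | |- measurable_fun _ (fun x => (@?f x)%:E) => apply: (proj2 (@measurable_EFinP _ _ _ _ f))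
  | |- measurable_fun _ (EFin \o ?f) => apply: (proj2 (@measurable_EFinP _ _ _ _ f))
  | |- measurable_fun _ (fun x => (@?f x * @?g x)%R) => apply: (@measurable_funM _ _ _ _ f g)
  | |- measurable_fun _ (fun x => (@?f x - @?g x)%R) => apply: (@measurable_funB _ _ _ _ f g)
  | |- measurable_fun _ (fun x => (@?f x + @?g x)%R) => apply: (@measurable_funD _ _ _ _ f g)
  | |- measurable_fun _ (fun x => (- @?f x)%R) => apply: (@measurable_funN _ _ _ _ f)
  | |- measurable_fun _ (fun x => (@?f x ^+ ?n)%R) => apply: (@measurable_funX _ _ _ _ f n)
  | |- measurable_fun _ (fun x => expR (@?f x)) => apply: (@measurableT_comp _ _ _ _
      (measurableTypeR _) _ expR _ f (@measurable_expR _))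
  | |- measurable_fun _ (fun x => (@?f x) `^ ?p) => apply: (@measurableT_comp _ _ _ _
      (measurableTypeR _) _ (fun y => y `^ p) _ f (measurable_powR p))
  | |- measurable_fun _ (fun x => pker ?a (@?f x)) => apply: (@measurableT_comp _ _ _ _
      (measurableTypeR _) _ (pker a) _ f (measurable_pker a))
  | |- measurable_fun _ (fun x => (@?f x < @?g x)%R) => apply: (@measurable_fun_ltr _ _ _ _ f g)
  | mF : measurable_fun setT ?F |- measurable_fun _ (fun x => ?F (@?u x)) => apply:
      (@measurableT_comp _ _ _ _ _ _ F _ u mF)
  end.
Ltac meas := do 40? meas_step.

(** Values of Gamma, powers, roots and factorials become free variables, leaving an identity of
    rational functions. Facts that they are nonzero must be moved into the goal beforehand so that
    they are generalised along with it. *)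
Ltac gen_atoms := repeat match goal with
  | |- context [Gamma ?a] => generalize (Gamma a)
  | |- context [Num.sqrt ?a] => generalize (Num.sqrt a)
  | |- context [?a `^ ?b] => generalize (a `^ b)
  | |- context [factorial ?n] => generalize (factorial n)
  end.
Ltac nonzeros := repeat match goal with
  | H : is_true ?P |- is_true ?P => exact H
  | |- is_true (_ && _) => apply/andP; split
  | |- is_true true => exact isT
  | |- is_true (_ ^+ _ != 0) => apply: expf_neq0
  | |- is_true (_%:R != 0) => by rewrite pnatr_eq0
  end.
Ltac field_gamma := gen_atoms; intros; field; nonzeros.

(** * Substitutions against power weights *)

Section mellin.
Context {R : realType}.
Local Notation mu := (@lebesgue_measure R).
Local Notation T := (measurableTypeR R).
Implicit Types (F : T -> \bar R) (a b c p : R).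
Local Open Scope ereal_scope.

Lemma integral_pker_itv a F :
  \int[mu]_x (F x * (pker a x)%:E) =
  \int[mu]_(x in `]0%R, +oo[) (F x * (x `^ (a - 1))%:E).
Proof.
rewrite [RHS]integral_mkcond; apply: eq_integral => x _ /=.
rewrite patchE mem_setE/= in_itv/= andbT /pker; case: ifP => //.
by rewrite mule0.
Qed.

Lemma mellin_expR a F : measurable_fun setT F -> (forall x, 0 <= F x) ->
  \int[mu]_x (F x * (pker a x)%:E) = \int[mu]_x (F (expR x) * (expR (a * x))%:E).
Proof.
move=> mF F0; rewrite [LHS](_ : _ = \int[mu]_(x in `]0%R, +oo[) (F x * (pker a x)%:E)).
  rewrite ge0_integral_expR; last 2 first.
  - by apply: emeasurable_funM => //; apply/measurable_EFinP; exact: measurable_pker.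
  - by move=> x; rewrite mule_ge0// lee_fin pker_ge0.
  by apply: eq_integral => x _; rewrite -muleA -EFinM pker_expR.
rewrite [RHS]integral_mkcond; apply: eq_integral => x _ /=.
rewrite patchE mem_setE/= in_itv/= andbT /pker; case: ifP => //.
by rewrite mule0.
Qed.

Lemma mellin_scale c a F : (0 < c)%R ->
  measurable_fun setT F -> (forall x, 0 <= F x) ->
  \int[mu]_x (F (c * x)%R * (pker a x)%:E) =
  (c `^ (- a))%:E * \int[mu]_x (F x * (pker a x)%:E).
Proof.
move=> c0 mF F0; rewrite !mellin_expR//; last first.
  by meas.
rewrite -[in RHS](ge0_integral_shift (ln c)); last 2 first.
- by meas.
- by move=> x; rewrite mule_ge0// lee_fin expR_ge0.
rewrite -ge0_integralZl_EFin ?powR_ge0//; last 2 first.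
- by move=> x _; rewrite mule_ge0// lee_fin expR_ge0.
- by meas.
apply: eq_integral => x _; rewrite muleCA -EFinM; congr (F _ * _%:E).
  by rewrite expRD lnK// mulrC.
by rewrite /powR gt_eqF// -expRD; congr expR; lra.
Qed.

(** Negative p is allowed, through a reflection in the logarithmic coordinate; p = -1 is what
    inverts the variable u of the Gaussian mixture. *)
Lemma mellin_powR p a F : (p != 0)%R ->
  measurable_fun setT F -> (forall x, 0 <= F x) ->
  \int[mu]_x (F (x `^ p)%R * (pker a x)%:E) =
  (`|p|^-1)%:E * \int[mu]_x (F x * (pker (a / p) x)%:E).
Proof.
move=> p0 mF F0; rewrite !mellin_expR//; last by meas.
pose G (x : T) := F (expR x) * (expR (a / p * x))%:E.
have mG : measurable_fun setT G.
  by rewrite /G; meas.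
have G0 x : 0 <= G x by rewrite /G mule_ge0// lee_fin expR_ge0.
have H x : F (expR x `^ p)%R * (expR (a * x))%:E = G (p * x)%R.
  by rewrite /G -expRM mulrC mulrA divfK// (mulrC p).
under eq_integral do rewrite H.
rewrite -[in RHS]/(G _).
have [pgt0|plt0] := ltP 0%R p.
  by rewrite gtr0_norm// -ge0_integral_scale.
rewrite ler0_norm// -ge0_integral_scale//; last by rewrite oppr_gt0 lt_neqAle p0.
rewrite -[LHS]ge0_integralN//.
- by apply: eq_integral => x _; rewrite mulrN mulNr.
- by meas.
Qed.

End mellin.

(** * Gamma and Beta integrals *)

Section gamma_beta.
Context {R : realType}.
Local Notation mu := (@lebesgue_measure R).
Local Notation T := (measurableTypeR R).
Implicit Types (F : T -> \bar R) (a b c p : R).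
Local Open Scope ereal_scope.

(** Both this and [gammaE] take extended values, so that their relation [gammaEM] holds for all
    parameters and can be used to prove finiteness. *)
Definition betaE a b : \bar R :=
  \int[mu]_x ((pker b (1 - x))%:E * (pker a x)%:E).

Definition gammaE a : \bar R :=
  \int[mu]_x ((expR (- x))%:E * (pker a x)%:E).

Lemma betaE_ge0 a b : 0 <= betaE a b.
Proof. by apply: integral_ge0 => x _; rewrite mule_ge0// lee_fin pker_ge0. Qed.

Lemma gammaE_ge0 a : 0 <= gammaE a.
Proof.
by apply: integral_ge0 => x _; rewrite mule_ge0// lee_fin ?pker_ge0// expR_ge0.
Qed.

(** The convolution of two power kernels is homogeneous of degree a + b - 1: scaling y by t leaves
    the value at t = 1 as the constant. For t <= 0 the supports do not meet. *)
Lemma integral_pker_pker a b (t : R) :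
  \int[mu]_y ((pker b (t - y))%:E * (pker a y)%:E) =
  (pker (a + b) t)%:E * betaE a b.
Proof.
have [t0|t0] := ltP 0%R t; last first.
  rewrite [pker (a + b) t]/pker ltNge t0 mul0e integral0_eq// => y _.
  rewrite -EFinM /pker; case: ifPn => [ty|]; last by rewrite mul0r.
  case: ifPn => [y0|]; last by rewrite mulr0.
  by exfalso; move: t0 ty y0; lra.
pose H (x : T) := (pker b (t * (1 - x)))%:E.
have mH : measurable_fun setT H by rewrite /H; meas.
have H0 x : 0 <= H x by rewrite lee_fin pker_ge0.
transitivity (\int[mu]_y (H (t^-1 * y)%R * (pker a y)%:E)).
  by apply: eq_integral => y _; rewrite /H mulrBr mulr1 mulVKf// gt_eqF.
rewrite mellin_scale ?invr_gt0//.
have HE x : H x = (t `^ (b - 1))%:E * (pker b (1 - x))%:E.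
  rewrite /H -EFinM /pker pmulr_rgt0//; case: ifPn => x1; last by rewrite mulr0.
  by rewrite powRM// ?ltW.
under eq_integral do rewrite HE -muleA.
rewrite ge0_integralZl_EFin ?powR_ge0//; last 2 first.
- by move=> x _; rewrite mule_ge0// lee_fin pker_ge0.
- by meas.
rewrite muleA -EFinM; congr (_%:E * _).
rewrite /pker t0 -powR_inv1 ?ltW// -powRrM -powRD; last by rewrite (gt_eqF t0) implybT.
by congr (_ `^ _)%R; lra.
Qed.

(** Take the sum y + t as a new variable and apply Tonelli; the integral over y at a fixed sum is
    the convolution just computed. With F = exp(-x) this is the Beta-Gamma relation, and with F
    radial it is the induction step for polar coordinates. *)
Lemma mellin_conv a b F : measurable_fun setT F -> (forall x, 0 <= F x) ->
  \int[mu]_y \int[mu]_t (F (y + t)%R * (pker b t)%:E * (pker a y)%:E) =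
  betaE a b * \int[mu]_x (F x * (pker (a + b) x)%:E).
Proof.
move=> mF F0.
pose G (z : T * T) := F z.2 * (pker b (z.2 - z.1))%:E * (pker a z.1)%:E.
have mG : measurable_fun setT G by rewrite /G; meas.
have G0 z : 0 <= G z by rewrite /G !mule_ge0// lee_fin pker_ge0.
transitivity (\int[mu]_y \int[mu]_t G (y, t)).
  apply: eq_integral => y _; rewrite -[RHS](ge0_integral_shift y).
  - by apply: eq_integral => t _; rewrite /G/= addrK addrC.
  - by rewrite /G/=; meas.
  - by move=> t.
rewrite fubini_tonelli//.
rewrite -ge0_integralZl//; last 3 first.
- by meas.
- by move=> x _; rewrite mule_ge0// lee_fin pker_ge0.
- exact: betaE_ge0.
apply: eq_integral => t _; rewrite /G/=.
under eq_integral do rewrite -muleA.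
rewrite ge0_integralZl//; last 2 first.
- by meas.
- by move=> x _; rewrite mule_ge0// lee_fin pker_ge0.
by rewrite integral_pker_pker muleA muleC.
Qed.

Lemma gammaEM a b : gammaE a * gammaE b = betaE a b * gammaE (a + b).
Proof.
rewrite [gammaE (a + b)]/gammaE -mellin_conv; last 2 first.
- by meas.
- by move=> x; rewrite lee_fin expR_ge0.
rewrite muleC -ge0_integralZl//; last 3 first.
- by meas.
- by move=> x _; rewrite mule_ge0// lee_fin ?pker_ge0// expR_ge0.
- exact: gammaE_ge0.
apply: eq_integral => y _.
rewrite [in LHS]muleC -ge0_integralZl//; last 3 first.
- by meas.
- by move=> x _; rewrite mule_ge0// lee_fin ?pker_ge0// expR_ge0.
- by rewrite mule_ge0// lee_fin ?pker_ge0// expR_ge0.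
apply: eq_integral => t _.
by rewrite -!EFinM opprD expRD; congr EFin; ring.
Qed.

Lemma betaEa1 a : (0 < a)%R -> betaE a 1 = (a^-1)%:E.
Proof.
move=> a0; rewrite /betaE mellin_expR; last 2 first.
- by meas.
- by move=> x; rewrite lee_fin pker_ge0.
pose G (x : T) : \bar R := ((fun y => (expR (- y))%:E) \_ `]0%R, +oo[) x.
have mG : measurable_fun setT G.
  by apply/(measurable_restrictT _ _).1 => //; apply: measurable_funTS; meas.
have G0 x : 0 <= G x.
  by rewrite /G patchE; case: ifP => // _; rewrite lee_fin expR_ge0.
transitivity (\int[mu]_x G (a * (- x))%R).
  apply: eq_integral => x _; rewrite /G patchE mem_setE/= in_itv/= andbT.
  rewrite mulrN oppr_gt0 pmulr_rlt0// opprK /pker subr_gt0 expR_lt1.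
  by case: ifP => _; rewrite ?mul0e// subrr powRr0 mul1e.
rewrite (@ge0_integralN _ (fun x => G (a * x)%R))//; last by meas.
rewrite ge0_integral_scale// /G -integral_mkcond.
rewrite integral_itv_obnd_cbnd; last by apply: measurable_funTS; meas.
by rewrite integral_expRN oppr0 expR0 mule1.
Qed.

End gamma_beta.

Section gamma_real.
Context {R : realType}.
Local Notation mu := (@lebesgue_measure R).
Local Notation T := (measurableTypeR R).
Implicit Types (F : T -> \bar R) (a b c p : R).

Lemma pker1 (x : T) : pker 1 x = (0 < x)%R%:R :> R.
Proof. by rewrite /pker subrr powRr0; case: ifP. Qed.

Lemma gammaE1 : gammaE 1 = 1%E :> \bar R.
Proof.
rewrite /gammaE integral_pker_itv subrr.
under eq_integral do rewrite powRr0 mule1.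
rewrite integral_itv_obnd_cbnd; last by apply: measurable_funTS; meas.
by rewrite integral_expRN oppr0 expR0.
Qed.

Lemma gammaES a : 0 < a -> gammaE (a + 1) = (a%:E * gammaE a)%E.
Proof.
move=> a0; have := gammaEM a 1; rewrite gammaE1 mule1 betaEa1// => ->.
by rewrite muleA -EFinM divff ?gt_eqF// mul1e.
Qed.

Lemma gammaE_nat n : gammaE n.+1%:R = (n`!%:R)%:E :> \bar R.
Proof.
elim: n => [|n IH]; first by rewrite gammaE1.
by rewrite -natr1 gammaES// IH factS -EFinM natrM.
Qed.

(** For 1 <= b <= n + 1 one has x^(b-1) <= 1 + x^n, so the integral is at most 1 + n!. The remaining
    a > 0 follow from the functional equation applied to a + 1. *)
Lemma gammaE_fin_num a : 0 < a -> gammaE a \is a fin_num.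
Proof.
have ge1 b : 1 <= b -> gammaE b \is a fin_num.
  move=> b1; pose n := (Num.trunc b).
  have bn : b <= n.+1%:R by apply/ltW/truncnS_gt.
  rewrite ge0_fin_numE ?gammaE_ge0//.
  apply: (@le_lt_trans _ _ (gammaE 1 + gammaE n.+1%:R)%E); last first.
    by rewrite gammaE1 gammaE_nat -EFinD ltry.
  rewrite /gammaE -ge0_integralD//; last 4 first.
  - by move=> x _; rewrite mule_ge0// lee_fin ?pker_ge0// expR_ge0.
  - by meas.
  - by move=> x _; rewrite mule_ge0// lee_fin ?pker_ge0// expR_ge0.
  - by meas.
  apply: ge0_le_integral => //.
  - by move=> x _; rewrite mule_ge0// lee_fin ?pker_ge0// expR_ge0.
  - by meas.
  - by apply: emeasurable_funD; meas.
  move=> x _; rewrite -!EFinM -EFinD lee_fin -mulrDr ler_wpM2l ?expR_ge0//.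
  rewrite /pker; case: ifPn => x0; last by rewrite addr0.
  have [x1|x1] := leP x 1.
    rewrite subrr powRr0 -[leLHS]addr0 lerD ?powR_ge0//.
    rewrite -[leRHS](powRr0 x); apply: ger_powR; rewrite ?x0//; lra.
  rewrite -[leLHS]add0r lerD ?powR_ge0//; apply: ler_powR; first exact: ltW.
  lra.
move=> a0; have := ge1 (a + 1); rewrite gammaES// => /(_ _)/wrap[]; first lra.
rewrite !ge0_fin_numE ?mule_ge0 ?gammaE_ge0// ?lee_fin ?ltW//.
have := gammaE_ge0 a; case: (gammaE a) => [r| |]// _.
  by move=> _; rewrite ltry.
by rewrite gt0_muley// lte_fin.
Qed.

Lemma GammaE a : 0 < a -> (Gamma a)%:E = gammaE a.
Proof.
move=> a0; rewrite -(fineK (gammaE_fin_num a a0)); congr (fine _)%:E.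
rewrite /gammaE integral_pker_itv; apply: eq_integral => x _.
by rewrite EFinM muleC.
Qed.

(** On (0,1) the exponential is at least e^(-1), which bounds Gamma(a) below by e^(-1) / a. *)
Lemma Gamma_gt0 a : 0 < a -> 0 < Gamma a.
Proof.
move=> a0; rewrite -lte_fin GammaE//.
apply: (@lt_le_trans _ _ ((expR (-1))%:E * betaE a 1)%E).
  by rewrite betaEa1// -EFinM lte_fin mulr_gt0 ?expR_gt0// invr_gt0.
rewrite /betaE /gammaE -ge0_integralZl_EFin ?expR_ge0//; last 2 first.
- by move=> x _; rewrite mule_ge0// lee_fin pker_ge0.
- by meas.
apply: ge0_le_integral => //.
- by move=> x _; rewrite !mule_ge0// lee_fin ?pker_ge0// expR_ge0.
- by meas.
- by meas.
move=> x _; rewrite -!EFinM lee_fin mulrA ler_wpM2r ?pker_ge0//.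
rewrite pker1 subr_gt0; case: (ltP x 1) => x1 /=.
  by rewrite mulr1 ler_expR lerN2 ltW.
by rewrite mulr0 expR_ge0.
Qed.

Lemma GammaS a : 0 < a -> Gamma (a + 1) = a * Gamma a.
Proof.
move=> a0; apply: EFin_inj; rewrite EFinM !GammaE ?gammaES//.
by rewrite addr_gt0.
Qed.

Lemma Gamma_nat n : Gamma n.+1%:R = n`!%:R :> R.
Proof. by apply: EFin_inj; rewrite GammaE ?ltr0n// gammaE_nat. Qed.

Lemma Gamma1 : Gamma 1 = 1 :> R.
Proof. exact: (Gamma_nat 0). Qed.

Lemma betaE_Gamma a b : 0 < a -> 0 < b ->
  betaE a b = (Gamma a * Gamma b / Gamma (a + b))%:E.
Proof.
move=> a0 b0; have ab0 : 0 < a + b by rewrite addr_gt0.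
have := gammaEM a b; rewrite -!GammaE// -EFinM => GE.
rewrite EFinM GE -muleA -EFinM divff ?mule1// gt_eqF// Gamma_gt0//.
Qed.

Lemma integral_expR_pker a c : 0 < a -> 0 < c ->
  (\int[mu]_x ((expR (- (c * x)))%:E * (pker a x)%:E) =
   (Gamma a * c `^ (- a))%:E)%E.
Proof.
move=> a0 c0.
rewrite (@mellin_scale _ c a (fun x => (expR (- x))%:E))//; last by meas.
by rewrite -/(gammaE a) -GammaE// -EFinM mulrC.
Qed.

(** The substitution x = y^2 turns the integral into twice the Gaussian integral over the
    half-line. *)
Lemma Gamma_half : Gamma 2^-1 = Num.sqrt pi :> R.
Proof.
apply: EFin_inj; rewrite GammaE ?invr_gt0//.
have := @mellin_powR R 2 1 (fun x => (expR (- x))%:E).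
rewrite div1r -/(gammaE _) => /(_ _ _ _)/wrap[] //.
- by meas.
rewrite integral_pker_itv subrr.
under eq_integral.
  move=> x; rewrite inE/= in_itv/= andbT => x0.
  rewrite powRr0 mule1 powR_mulrn ?(ltW x0)//.
  over.
rewrite -[X in X = _]/(\int[mu]_(x in `]0%R, +oo[) (gauss_fun x)%:E)%E.
rewrite integral_itv_obnd_cbnd; last first.
  by apply/measurable_EFinP; apply: measurable_funTS; exact: measurable_gauss_fun.
rewrite integral0y_gauss ger0_norm// => /(congr1 (fun x => 2%:E * x)%E).
by rewrite muleA -!EFinM divff// mul1e mulrC divfK// => ->.
Qed.

(** Legendre's duplication formula at half-integers. Passing from n to n + 1 exchanges the two Gamma
    factors on the right, up to one use of the functional equation, so induction suffices. *)
Lemma Gamma_duplication_nat n : Gamma (n%:R + 1) =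
  2 ^+ n * Gamma ((n%:R + 1) / 2) * Gamma (n%:R / 2 + 1) / Num.sqrt pi :> R.
Proof.
have pi0 : Num.sqrt pi != 0 :> R by rewrite gt_eqF// sqrtr_gt0 pi_gt0.
elim: n => [|n IH].
  by rewrite add0r mul0r add0r expr0 mul1r div1r Gamma_half Gamma1 mulr1 divff.
have n0 : 0 < n%:R + 1 :> R by rewrite natr1.
rewrite -[n.+1%:R]natr1 GammaS// IH.
have -> : (n%:R + 1 + 1) / 2 = n%:R / 2 + 1 :> R by lra.
rewrite (GammaS ((n%:R + 1) / 2)) ?divr_gt0// exprS.
by field.
Qed.

End gamma_real.

Opaque Gamma.

(** * Gauss's summation theorem *)

Section series.
Context {R : realType}.
Implicit Types (u : nat -> R).

Lemma nneseries_EFin u (l : R) : (forall n, 0 <= u n) ->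
  (\sum_(0 <= n <oo) (u n)%:E = l%:E)%E <-> series u @ \oo --> l.
Proof.
move=> u0.
have sE : (fun n => \sum_(0 <= k < n) (u k)%:E)%E = EFin \o series u.
  by apply/funext => n; rewrite /series/= sumEFin.
split=> [ul|ul]; last first.
  rewrite sE; apply/cvg_lim => //.
  by apply: cvg_EFin => //; exact: nearW.
have cv : (fun n => \sum_(0 <= k < n) (u k)%:E)%E @ \oo --> l%:E.
  by rewrite -ul; apply: is_cvg_nneseries => n _ _; rewrite lee_fin.
by move: cv; rewrite sE => /fine_cvgP[].
Qed.

Lemma nneseries_expR (x : R) : 0 <= x ->
  (\sum_(0 <= n <oo) (x ^+ n / n`!%:R)%:E = (expR x)%:E)%E.
Proof.
move=> x0; apply/nneseries_EFin.
  by move=> n; rewrite mulr_ge0// ?exprn_ge0// invr_ge0.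
exact: is_cvg_series_exp_coeff.
Qed.

End series.

Section gauss_sum.
Context {R : realType}.
Local Notation mu := (@lebesgue_measure R).
Local Notation T := (measurableTypeR R).
Implicit Types (a b c x : R).

Lemma pkerDn a n (x : T) : pker (a + n%:R) x = x ^+ n * pker a x.
Proof.
have [x0|x0] := ltP 0 x; last by rewrite /pker ltNge x0 mulr0.
by rewrite pkerM// powR_mulrn// ltW.
Qed.

(* Expand exp(u x) in Gamma(a) (1 - x)^(-a) = int_0^oo u^(a-1) exp(- u (1 - x)) du. *)
Lemma binomial_series a x : 0 < a -> 0 < x < 1 ->
  (\sum_(0 <= n <oo) (Gamma (a + n%:R) * x ^+ n / n`!%:R)%:E =
  (Gamma a * (1 - x) `^ (- a))%:E)%E.
Proof.
move=> a0 /andP[x0 x1]; rewrite -integral_expR_pker ?subr_gt0//.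
pose f n (u : T) : \bar R := ((x ^+ n / n`!%:R)%:E * ((expR (- u))%:E * (pker (a + n%:R) u)%:E))%E.
have f0 n u : (0 <= f n u)%E.
  rewrite /f !mule_ge0// lee_fin ?expR_ge0// ?pker_ge0//.
  by rewrite mulr_ge0// ?exprn_ge0 ?invr_ge0// ltW.
transitivity (\sum_(0 <= n <oo) \int[mu]_u f n u)%E.
  apply: eq_eseriesr => n _; rewrite /f ge0_integralZl_EFin//; last 3 first.
  - by move=> u _; rewrite mule_ge0// lee_fin ?pker_ge0// expR_ge0.
  - by meas.
  - by rewrite mulr_ge0// ?exprn_ge0 ?invr_ge0// ltW.
  rewrite -/(gammaE _) -GammaE -?EFinM; last by rewrite ltr_wpDr.
  by congr EFin; ring.
rewrite -integral_nneseries//; last by move=> n; rewrite /f; meas.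
apply: eq_integral => u _.
have [u0|u0] := ltP 0 u; last first.
  rewrite /pker ltNge u0 mule0 eseries0// => n _ _.
  by rewrite /f /pker ltNge u0 !mule0.
transitivity (\sum_(0 <= n <oo) ((expR (- u) * pker a u)%:E * ((u * x) ^+ n / n`!%:R)%:E))%E.
  apply: eq_eseriesr => n _; rewrite /f pkerDn -!EFinM; congr EFin.
  by rewrite exprMn; ring.
rewrite nneseriesZl; last first.
  by move=> n _; rewrite lee_fin mulr_ge0// ?exprn_ge0 ?invr_ge0// mulr_ge0// ltW.
rewrite nneseries_expR; last by rewrite mulr_ge0// ltW.
rewrite -!EFinM; congr EFin; rewrite mulrAC -expRD; congr (expR _ * _).
ring.
Qed.

Lemma risingE a n : 0 < a -> rising a n = Gamma (a + n%:R) / Gamma a.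
Proof.
move=> a0; have Ga : Gamma a != 0 by rewrite gt_eqF// Gamma_gt0.
elim: n => [|n IH]; first by rewrite /rising big_ord0 addr0 divff.
rewrite /rising big_ord_recr/= -/(rising a n) IH -natr1 addrA GammaS; last first.
  by rewrite ltr_wpDr.
by rewrite mulrC mulrA.
Qed.

Lemma hyp2F1_gauss a b c : 0 < a -> 0 < b -> a + b < c ->
  hyp2F1 a b c 1 =
  Gamma c * Gamma (c - a - b) / (Gamma (c - a) * Gamma (c - b)).
Proof.
move=> a0 b0 abc.
have c0 : 0 < c by lra.
have cb0 : 0 < c - b by lra.
have ca0 : 0 < c - a by lra.
have cab0 : 0 < c - a - b by lra.
have nat_gt0 (z : R) n : 0 < z -> 0 < z + n%:R by move=> z0; rewrite ltr_wpDr.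
apply/cvg_lim => //; apply/nneseries_EFin.
  move=> n; rewrite expr1n mulr1 !risingE// !mulr_ge0// ?invr_ge0//
    ?mulr_ge0// ?invr_ge0// ltW// Gamma_gt0//; exact: nat_gt0.
(* Gamma(c) / (Gamma(b) Gamma(c-b)) is the prefactor 1 / B(b, c-b) of Euler's integral; the extra 1
   / Gamma(a) turns the rising factorial of a into Gamma(a+n). *)
pose K := Gamma c / (Gamma a * Gamma b * Gamma (c - b)).
have K0 : 0 <= K by rewrite divr_ge0 ?mulr_ge0// ltW// Gamma_gt0.
pose f n (x : T) : \bar R :=
  ((Gamma (a + n%:R) / n`!%:R)%:E * ((pker (c - b) (1 - x))%:E * (pker (b + n%:R) x)%:E))%E.
have g0 n : 0 <= Gamma (a + n%:R) / n`!%:R.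
  by rewrite divr_ge0// ltW// Gamma_gt0// nat_gt0.
have f0 n x : (0 <= f n x)%E.
  by rewrite /f !mule_ge0// lee_fin ?pker_ge0.
transitivity (K%:E * \sum_(0 <= n <oo) \int[mu]_x f n x)%E.
  rewrite -nneseriesZl//; last by move=> n _; exact: integral_ge0.
  apply: eq_eseriesr => n _; rewrite /f ge0_integralZl_EFin//; last 2 first.
  - by move=> x _; rewrite mule_ge0// lee_fin pker_ge0.
  - by meas.
  rewrite -/(betaE _ _) betaE_Gamma//; last exact: nat_gt0.
  rewrite -!EFinM; congr EFin; rewrite expr1n !risingE// /K.
  rewrite (_ : b + n%:R + (c - b) = c + n%:R); last by ring.
  have /lt0r_neq0 := @Gamma_gt0 R c c0.
  have /lt0r_neq0 := @Gamma_gt0 R a a0.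
  have /lt0r_neq0 := @Gamma_gt0 R b b0.
  have /lt0r_neq0 := @Gamma_gt0 R _ cb0.
  have : Gamma (c + n%:R) != 0 by apply: lt0r_neq0; apply: Gamma_gt0; exact: nat_gt0.
  have : n`!%:R != 0 :> R by rewrite pnatr_eq0 -lt0n fact_gt0.
  by field_gamma.
rewrite -integral_nneseries//; last by move=> n; rewrite /f; meas.
transitivity (K%:E * \int[mu]_x ((Gamma a)%:E * ((pker (c - a - b) (1 - x))%:E * (pker b x)%:E)))%E.
  congr (_ * _)%E; apply: eq_integral => x _.
  have [x0|x0] := ltP 0 x; last first.
    rewrite [pker b x]/pker ltNge x0 !mule0 eseries0// => n _ _.
    by rewrite /f [pker (b + _) x]/pker ltNge x0 !mule0.
  have [x1|x1] := ltP x 1; last first.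
    rewrite [pker _ (1 - x)]/pker subr_gt0 ltNge x1 mul0e mule0 eseries0// => n _ _.
    by rewrite /f [pker _ (1 - x)]/pker subr_gt0 ltNge x1 mul0e mule0.
  transitivity (\sum_(0 <= n <oo) ((pker (c - b) (1 - x) * pker b x)%:E * (Gamma (a + n%:R) * x
      ^+ n / n`!%:R)%:E))%E.
    by apply: eq_eseriesr => n _; rewrite /f pkerDn -!EFinM; congr EFin; ring.
  rewrite nneseriesZl; last first.
    by move=> n _; rewrite lee_fin mulrAC mulr_ge0// exprn_ge0// ltW.
  rewrite binomial_series ?x0// -!EFinM; congr EFin.
  (* The binomial sum (1-x)^(-a) lowers the exponent at 1, so a Beta integral with parameters b and
     c - a - b remains. *)
  rewrite (_ : c - a - b = (c - b) + (- a)); last by ring.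
  rewrite (pkerM (c - b) (- a)) ?subr_gt0//.
  ring.
rewrite ge0_integralZl_EFin//; last 3 first.
- by move=> x _; rewrite mule_ge0// lee_fin pker_ge0.
- by meas.
- by rewrite ltW// Gamma_gt0.
rewrite -/(betaE _ _) betaE_Gamma// -!EFinM; congr EFin; rewrite /K.
rewrite (_ : b + (c - a - b) = c - a); last by ring.
have /lt0r_neq0 := @Gamma_gt0 R a a0.
have /lt0r_neq0 := @Gamma_gt0 R b b0.
have /lt0r_neq0 := @Gamma_gt0 R _ cb0.
have /lt0r_neq0 := @Gamma_gt0 R _ ca0.
by field_gamma.
Qed.

End gauss_sum.

(** * The power series of the square of a Bessel function *)

Section vandermonde.
Context {R : comPzRingType}.
Implicit Types x y : R.

Definition falling x (k : nat) : R := \prod_(i < k) (x - i%:R).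

Lemma fallingS x k : falling x k.+1 = falling x k * (x - k%:R).
Proof. by rewrite /falling big_ord_recr. Qed.

(** In the induction the new factor x + y - N is split as (x - i) + (y - (N - i)), each part
    lengthening one falling factorial; Pascal's rule collects the terms. *)
Lemma falling_vandermonde N x y :
  \sum_(i < N.+1) falling x i * falling y (N - i) *+ 'C(N, i) =
  falling (x + y) N.
Proof.
elim: N => [|N IH]; first by rewrite big_ord1 /falling !big_ord0 mulr1.
rewrite fallingS -IH mulr_suml.
pose a i := falling x i * falling y (N.+1 - i).
transitivity (\sum_(i < N.+1) (a i.+1 + a i) *+ 'C(N, i)).
  rewrite big_ord_recl/= bin0 -/(a 0%N).
  under eq_bigr do rewrite -/(a _) binS mulrnDr.
  rewrite big_split/= addrA addrC.
  under [RHS]eq_bigr do rewrite mulrnDl.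
  rewrite big_split/=; congr (_ + _).
  rewrite [in RHS]big_ord_recl/= bin0; congr (_ + _).
  by rewrite big_ord_recr/= bin_small// mulr0n addr0.
apply: eq_bigr => i _; rewrite mulrnAl; congr (_ *+ _).
have iN : (i <= N)%N by rewrite -ltnS.
have -> : N%:R = i%:R + (N - i)%:R :> R by rewrite -natrD subnKC.
rewrite /a subSS subSn// !fallingS.
ring.
Qed.

End vandermonde.

Section cauchy_square.
Context {R : realType}.
Implicit Types u : nat -> R.

Definition cauchy_sqr u (N : nat) : R := \sum_(i < N.+1) u i * u (N - i)%N.

Lemma cauchy_sqr_ge0 u N : (forall n, 0 <= u n) -> 0 <= cauchy_sqr u N.
Proof. by move=> u0; apply: sumr_ge0 => i _; rewrite mulr_ge0. Qed.

Lemma ler_norm_cauchy_sqr u N :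
  `|cauchy_sqr u N| <= cauchy_sqr (fun n => `|u n|) N.
Proof.
apply: (le_trans (ler_norm_sum _ _ _)).
by apply: ler_sum => i _; rewrite normrM.
Qed.

Let trunc u K n := if (n < K)%N then u n else 0.

Let trunc_small u K N : (N < K)%N -> cauchy_sqr (trunc u K) N = cauchy_sqr u N.
Proof.
move=> NK; apply: eq_bigr => i _; rewrite /trunc.
rewrite (leq_ltn_trans (leq_subr _ _) NK).
by rewrite (leq_ltn_trans _ NK)// -ltnS.
Qed.

(** Partial sums of u are values at 1 of polynomials with coefficients u, so this is the coefficient
    formula for a polynomial product, summed over a range that covers its degree. *)
Let sqr_series u K :
  series u K ^+ 2 = series (cauchy_sqr (trunc u K)) (K + K)%N.
Proof.
rewrite /series/= !big_mkord.
have pE : \sum_(i < K) u i = (\poly_(i < K) u i).[1].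
  by rewrite horner_poly; apply: eq_bigr => i _; rewrite expr1n mulr1.
rewrite pE -horner_exp (horner_coef_wide (n := (K + K)%N)); last first.
  rewrite expr2 (leq_trans (size_polyMleq _ _))//.
  by rewrite (leq_trans (leq_pred _))// leq_add// size_poly.
apply: eq_bigr => i _; rewrite expr1n mulr1 expr2 coefM.
by apply: eq_bigr => j _; rewrite !coef_poly.
Qed.

Let sqr_series_split u K : series u K ^+ 2 - series (cauchy_sqr u) K =
  \sum_(K <= N < K + K) cauchy_sqr (trunc u K) N.
Proof.
rewrite sqr_series /series/= (big_cat_nat (n := K))//=; last exact: leq_addr.
rewrite addrAC (eq_big_nat _ _ (F2 := cauchy_sqr u)) ?subrr ?add0r// => N /andP[_ NK].
exact: trunc_small.
Qed.

Let series_sqr_le u K : (forall n, 0 <= u n) ->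
  series u K ^+ 2 <= series (cauchy_sqr u) (K + K)%N.
Proof.
move=> u0; rewrite sqr_series; apply: ler_sum => N _; apply: ler_sum => i _.
by rewrite /trunc ler_pM//; case: ifP.
Qed.

(** With S_K and C_K the partial sums of u and of its Cauchy square, C_K <= S_K^2 <= C_(2K). *)
Let cvg_cauchy_sqr_ge0 u : (forall n, 0 <= u n) -> cvgn (series u) ->
  series (cauchy_sqr u) @ \oo --> (limn (series u)) ^+ 2.
Proof.
move=> u0 cu.
have nds : nondecreasing_seq (series u) by apply: nondecreasing_series => n _ _.
have nd : nondecreasing_seq (series (cauchy_sqr u)).
  by apply: nondecreasing_series => n _ _; exact: cauchy_sqr_ge0.
have le K : series (cauchy_sqr u) K <= limn (series u) ^+ 2.
  apply: (@le_trans _ _ (series u K ^+ 2)).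
    rewrite -subr_ge0 sqr_series_split; apply: sumr_ge0 => N _.
    by apply: cauchy_sqr_ge0 => n; rewrite /trunc; case: ifP.
  rewrite ler_sqr ?nnegrE; first exact: nondecreasing_cvgn_le.
    by apply: sumr_ge0.
  by apply: limr_ge => //; apply: nearW => n; apply: sumr_ge0.
have cvc : cvgn (series (cauchy_sqr u)).
  apply: nondecreasing_is_cvgn => //.
  by exists (limn (series u) ^+ 2) => _ [K _ <-].
rewrite (_ : _ ^+ 2 = limn (series (cauchy_sqr u))); first exact: cvc.
apply/eqP; rewrite eq_le; apply/andP; split; last first.
  by apply: limr_le => //; exact: nearW.
have sq : (fun K => series u K ^+ 2) @ \oo --> limn (series u) ^+ 2.
  by apply: cvgM; exact: cu.
rewrite -(cvg_lim _ sq)//; apply: limr_le; first by apply/cvg_ex; eexists; exact: sq.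
apply: nearW => K; apply: (le_trans (series_sqr_le u K u0)).
exact: nondecreasing_cvgn_le.
Qed.

(* The difference between the square of a partial sum of u and the partial sum of
   the Cauchy square is dominated by the same difference for the series |u|. *)
Lemma cvg_cauchy_sqr u : cvgn (series (fun n => `|u n|)) ->
  series (cauchy_sqr u) @ \oo --> (limn (series u)) ^+ 2.
Proof.
move=> cu.
have cu' : cvgn (series u) by exact: normed_cvg.
have sq : (fun K => series u K ^+ 2) @ \oo --> limn (series u) ^+ 2.
  by apply: cvgM; exact: cu'.
have d0 : (fun K => series (fun n => `|u n|) K ^+ 2 -
    series (cauchy_sqr (fun n => `|u n|)) K) @ \oo --> (0 : R).
  rewrite -(subrr (limn (series (fun n => `|u n|)) ^+ 2)); apply: cvgB.
    by apply: cvgM; exact: cu.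
  exact: cvg_cauchy_sqr_ge0.
have e0 : (fun K => series u K ^+ 2 - series (cauchy_sqr u) K) @ \oo --> (0 : R).
  apply: norm_cvg0; apply: (squeeze_cvgr _ (cvg_cst 0) d0); apply: nearW => K.
  rewrite normr_ge0/= !sqr_series_split (le_trans (ler_norm_sum _ _ _))//.
  apply: ler_sum => N _; apply: (le_trans (ler_norm_cauchy_sqr _ _)).
  apply: ler_sum => i _; rewrite /trunc.
  by do 2 case: ifP => _; rewrite ?normr0.
rewrite (_ : series _ = (fun K => series u K ^+ 2 - (series u K ^+ 2 - series (cauchy_sqr u) K))).
  by rewrite -[X in _ --> X]subr0; apply: cvgB.
by apply/funext => K; rewrite subKr.
Qed.

End cauchy_square.

(** * Termwise integration of alternating series *)

Section alternating.
Context (d : measure_display) (T : measurableType d) (R : realType).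
Context (mu : {measure set T -> \bar R}).
Context (f : nat -> T -> R) (S : T -> R) (r : nat -> R).
Hypothesis mf : forall n, measurable_fun setT (f n).
Hypothesis f0 : forall n x, 0 <= f n x.
Hypothesis fS : forall x, series (fun n => (-1) ^+ n * f n x) @ \oo --> S x.
Hypothesis fr : forall n, (\int[mu]_x (f n x)%:E = (r n)%:E)%E.
Hypothesis rfin : (\sum_(0 <= n <oo) (r n)%:E < +oo)%E.

Lemma measurable_alternating : measurable_fun setT S.
Proof.
apply: (@measurable_fun_cvg _ _ _ setT (fun m x => series (fun n => (-1) ^+ n * f n x) m)) => //.
move=> m; rewrite /series/=; apply: measurable_sum => n.
exact: measurable_funM.
Qed.

(** Dominated convergence with the sum of all f n as the bound, integrable because the r n are
    summable. The limit depends on f only through r, so two functions whose expansions have the same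
    termwise integrals have the same integral. *)
Lemma cvg_integral_alternating :
  (fun K => (series (fun n => (-1) ^+ n * r n) K)%:E) @ \oo -->
  (\int[mu]_x (S x)%:E)%E.
Proof.
have intf n : mu.-integrable setT (EFin \o f n).
  apply/integrableP; split; first exact/measurable_EFinP.
  under eq_integral do rewrite /= ger0_norm//.
  by rewrite fr ltry.
have ints n : mu.-integrable setT (EFin \o (fun x => (-1) ^+ n * f n x)).
  by have := @integrableZl _ _ _ mu setT measurableT ((-1) ^+ n) _ (intf n).
pose g (x : T) := (\sum_(0 <= n <oo) (f n x)%:E)%E.
have mg : measurable_fun setT g.
  by apply: ge0_emeasurable_sum => [n x _ _|n _]; [rewrite lee_fin|exact/measurable_EFinP].
have g0 x : (0 <= g x)%E by apply: nneseries_ge0 => n _ _; rewrite lee_fin.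
have ig : mu.-integrable setT g.
  apply/integrableP; split => //.
  under eq_integral do rewrite gee0_abs//.
  rewrite /g integral_nneseries//; last 2 first.
  - by move=> n; exact/measurable_EFinP.
  - by move=> n x _; rewrite lee_fin.
  by rewrite (eq_eseriesr (g := fun n => (r n)%:E))// => n _; exact: fr.
have ms K : measurable_fun setT (fun x => (series (fun n => (-1) ^+ n * f n x) K)%:E).
  apply/measurable_EFinP; rewrite /series/=; apply: measurable_sum => m.
  exact: measurable_funM.
have mS : measurable_fun setT (EFin \o S).
  by apply/measurable_EFinP; exact: measurable_alternating.
have cS : {ae mu, forall x, setT x ->
    (fun K => (series (fun n => (-1) ^+ n * f n x) K)%:E) @ \oo --> (S x)%:E}.
  by apply: aeW => x _; apply: cvg_EFin; [exact: nearW|exact: fS].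
have dg : {ae mu, forall x K, setT x ->
    (`|(series (fun n => (-1) ^+ n * f n x) K)%:E| <= g x)%E}.
  apply: aeW => x K _; apply: (@le_trans _ _ (\sum_(0 <= n < K) (f n x)%:E)%E); last first.
    by apply: nneseries_lim_ge => n _ _; rewrite lee_fin.
  rewrite abse_EFin sumEFin lee_fin (le_trans (ler_norm_sum _ _ _))//.
  by apply: ler_sum => n _; rewrite normrM normrX normrN1 expr1n mul1r ger0_norm.
have [_ _] := dominated_convergence measurableT ms mS cS ig dg.
move=> h; rewrite (_ : (fun K => _) = (fun K => \int[mu]_x (series (fun n => (-1) ^+ n * f n x)
    K)%:E)%E)//.
apply/funext => K; rewrite /series/=.
under [RHS]eq_integral do rewrite -sumEFin.
rewrite integral_sum//.
rewrite -sumEFin; apply: eq_bigr => n _.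
rewrite EFinM -fr -(integralZl measurableT (intf n)).
by apply: eq_integral => x _; rewrite EFinM.
Qed.

End alternating.

Section bessel_coefficients.
Context {R : realType}.
Implicit Types (nu t x : R).

Lemma Gamma_falling x k : k%:R < x + 1 ->
  Gamma (x + 1) = falling x k * Gamma (x + 1 - k%:R).
Proof.
elim: k => [|k IH]; first by rewrite /falling big_ord0 mul1r subr0.
rewrite -natr1 => kx; rewrite IH; last by lra.
rewrite fallingS -mulrA; congr (_ * _).
rewrite (_ : x + 1 - k%:R = (x - k%:R) + 1); last by ring.
rewrite GammaS; last by lra.
by congr (_ * Gamma _); ring.
Qed.

Definition bessel_coef nu (m : nat) : R := (m`!%:R * Gamma (m%:R + nu + 1))^-1.

Lemma bessel_Gamma_gt0 nu (m : nat) : 0 <= nu -> 0 < Gamma (m%:R + nu + 1).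
Proof. by move=> nu0; rewrite Gamma_gt0// ltr_wpDl// addr_ge0. Qed.

Lemma bessel_coef_ge0 nu m : 0 <= nu -> 0 <= bessel_coef nu m.
Proof.
move=> nu0; by rewrite invr_ge0 mulr_ge0// ltW// bessel_Gamma_gt0.
Qed.

(** With x = N + nu, 1 / Gamma(N-k+nu+1) is the falling factorial of x of length k divided by
    Gamma(x+1), and the factorials form a binomial coefficient. The sum is then Vandermonde's with
    both arguments equal to x. *)
Lemma cauchy_sqr_bessel nu N : 0 <= nu ->
  cauchy_sqr (bessel_coef nu) N = Gamma (2 * nu + 2 * N%:R + 1) /
    (N`!%:R * Gamma (nu + N%:R + 1) ^+ 2 * Gamma (2 * nu + N%:R + 1)).
Proof.
move=> nu0; pose x := N%:R + nu.
have E1 : 2 * nu + 2 * N%:R + 1 = x + x + 1 by rewrite /x; ring.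
have E2 : 2 * nu + N%:R + 1 = x + x + 1 - N%:R by rewrite /x; ring.
have E3 : nu + N%:R + 1 = x + 1 by rewrite /x; ring.
have GG : Gamma (x + x + 1) = falling (x + x) N * Gamma (x + x + 1 - N%:R).
  rewrite (Gamma_falling (x + x) N)// -subr_gt0 -E2 ltr_wpDl//.
  by rewrite addr_ge0// mulr_ge0.
have P1 : Gamma (x + x + 1 - N%:R) != 0.
  by rewrite gt_eqF// -E2 Gamma_gt0// ltr_wpDl// addr_ge0// mulr_ge0.
have P2 : Gamma (x + 1) != 0 by rewrite gt_eqF// bessel_Gamma_gt0.
have P3 k : k`!%:R != 0 :> R by rewrite pnatr_eq0 -lt0n fact_gt0.
rewrite E1 E2 E3 GG -falling_vandermonde mulr_suml mulr_suml; apply: eq_bigr => i _.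
have iN : (i <= N)%N by rewrite -ltnS.
have NE : (N - i)%:R = N%:R - i%:R :> R by rewrite natrB.
have G k : (k <= N)%N -> falling x k = Gamma (x + 1) / Gamma ((N - k)%:R + nu + 1).
  move=> kN; rewrite (@Gamma_falling x k); last first.
    by rewrite (@le_lt_trans _ _ N%:R) ?ler_nat// /x -addrA ltrDl ltr_wpDl.
  rewrite (_ : x + 1 - k%:R = (N - k)%:R + nu + 1).
    by rewrite (mulfK (lt0r_neq0 (bessel_Gamma_gt0 _ _ nu0))).
  by rewrite natrB// /x; ring.
have F1 := G _ (leq_subr i N); rewrite (subKn iN) in F1.
have F2 := G _ iN.
have P4 : Gamma (i%:R + nu + 1) != 0 by rewrite gt_eqF// bessel_Gamma_gt0.
have P5 : Gamma ((N - i)%:R + nu + 1) != 0 by rewrite gt_eqF// bessel_Gamma_gt0.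
have B : ('C(N, i))%:R = N`!%:R / (i`!%:R * (N - i)`!%:R) :> R.
  by rewrite -(bin_fact iN) !natrM mulfK// mulf_neq0.
rewrite /bessel_coef F1 F2 -[in RHS]mulr_natr B.
move: P1 P2 P4 P5 (P3 i) (P3 N) (P3 (N - i)%N); field_gamma.
Qed.

End bessel_coefficients.

Section bessel_square.
Context {R : realType} (d : nat).
Local Notation T := (measurableTypeR R).
Local Notation nu := (d%:R / 2 : R).
Implicit Types t : R.

Lemma nu_ge0 : 0 <= nu. Proof. by rewrite divr_ge0. Qed.

(** The absolute value of the coefficient of t^(d+2N) in the square of J_(d/2); as the order is d/2,
    the square has only integer powers of t. *)
Definition bessel_sqr_coef N : R :=
  cauchy_sqr (bessel_coef nu) N / 2 ^+ (d + 2 * N).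

(** The factor Gamma(d/2+N+1) comes from integrating t^(d+2N+1) against a Gaussian. The duplication
    formula at d + 2N cancels it together with the power of 2, leaving what is needed for a Beta
    integral. *)
Lemma bessel_sqr_coefE N :
  bessel_sqr_coef N * Gamma (nu + N%:R + 1) =
  Gamma (nu + 2^-1 + N%:R) / (Num.sqrt pi * N`!%:R * Gamma (2 * nu + N%:R + 1)).
Proof.
have nu0 := nu_ge0.
have P0 : Num.sqrt pi != 0 :> R by rewrite gt_eqF// sqrtr_gt0 pi_gt0.
have P1 : N`!%:R != 0 :> R by rewrite pnatr_eq0 -lt0n fact_gt0.
have N0 : 0 <= N%:R :> R by [].
have P2 : Gamma (nu + N%:R + 1) != 0 by rewrite gt_eqF// Gamma_gt0//; lra.
have P3 : Gamma (2 * nu + N%:R + 1) != 0 by rewrite gt_eqF// Gamma_gt0//; lra.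
have P4 : (2 : R) ^+ (d + 2 * N) != 0 by rewrite expf_neq0.
rewrite /bessel_sqr_coef cauchy_sqr_bessel//.
have -> : 2 * nu + 2 * N%:R + 1 = (d + 2 * N)%:R + 1.
  by rewrite natrD natrM; field.
rewrite Gamma_duplication_nat.
have -> : ((d + 2 * N)%:R + 1) / 2 = nu + 2^-1 + N%:R :> R.
  by rewrite natrD natrM; field.
have -> : (d + 2 * N)%:R / 2 + 1 = nu + N%:R + 1 :> R.
  by rewrite natrD natrM; field.
move: P0 P1 P2 P3; generalize (d + 2 * N)%N; field_gamma.
Qed.

Lemma bessel_sqr_coef_ge0 N : 0 <= bessel_sqr_coef N.
Proof.
rewrite divr_ge0// cauchy_sqr_ge0// => n.
by rewrite bessel_coef_ge0// nu_ge0.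
Qed.

(** Gamma(m+nu+1) is nondecreasing in m, since Gamma(x+1) = x Gamma(x) with x >= 1; hence the series
    is dominated by that of exp(z) / Gamma(nu+1). *)
Lemma cvg_bessel_series (z : R) : 0 <= z ->
  cvgn (series (fun m => bessel_coef nu m * z ^+ m)).
Proof.
move=> z0; have nu0 := nu_ge0.
have G0 : 0 < Gamma (nu + 1) by rewrite Gamma_gt0//; lra.
apply: (@series_le_cvg _ _ (fun m => (Gamma (nu + 1))^-1 * exp_coeff z m)).
- by move=> n; rewrite mulr_ge0 ?exprn_ge0// bessel_coef_ge0.
- by move=> n; rewrite mulr_ge0 ?invr_ge0 ?(ltW G0)// exp_coeff_ge0.
- move=> n; rewrite /bessel_coef /exp_coeff/= mulrCA mulrC ler_wpM2l ?exprn_ge0//.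
  rewrite invfM mulrC ler_wpM2r ?invr_ge0// lef_pV2; [|exact: bessel_Gamma_gt0|exact: G0].
  elim: n => [|n IH]; first by rewrite add0r.
  apply: (le_trans IH); rewrite (_ : n.+1%:R + nu + 1 = (n%:R + nu + 1) + 1); last first.
    by rewrite -natr1; ring.
  have n0 : 0 <= n%:R :> R by [].
  rewrite (GammaS (n%:R + nu + 1)); last by rewrite ltr_wpDl// addr_ge0.
  by rewrite ler_peMl ?(ltW (bessel_Gamma_gt0 _ _ _))// lerDr addr_ge0.
- exact/is_cvg_seriesZ/is_cvg_series_exp_coeff.
Qed.

Lemma cvg_bessel_sqr t :
  series (fun N => (-1) ^+ N * (bessel_sqr_coef N * pker (2 + (d + 2 * N)%:R) t))
    @ \oo --> pker 2 t * besselJ nu t ^+ 2.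
Proof.
have [t0|t0] := ltP 0 t; last first.
  rewrite {2}/pker ltNge t0 mul0r.
  rewrite (_ : series _ = cst 0); first exact: cvg_cst.
  apply/funext => n; rewrite /series/= big1// => i _.
  by rewrite /pker ltNge t0 !mulr0.
(* The Bessel function is (t/2)^nu times an alternating power series in z, and the signs in each
   Cauchy coefficient multiply to (-1)^N. *)
pose z := (t / 2) ^+ 2.
have z0 : 0 <= z by rewrite exprn_ge0// divr_ge0// ltW.
have t2 : 0 < t / 2 by rewrite divr_gt0.
pose u m := (-1) ^+ m * (bessel_coef nu m * z ^+ m).
have cu : cvgn (series (fun n => `|u n|)).
  rewrite (_ : (fun n => _) = (fun m => bessel_coef nu m * z ^+ m)); first exact: cvg_bessel_series.
  apply/funext => n; rewrite /u normrM normrX normrN1 expr1n mul1r ger0_norm//.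
  by apply: mulr_ge0; [exact: bessel_coef_ge0 nu_ge0|exact: exprn_ge0].
have JE : besselJ nu t = (t / 2) `^ nu * limn (series u).
  have cu' : cvgn (series u) by exact: normed_cvg.
  rewrite /besselJ [X in limn X](_ : _ = (fun n => (t / 2) `^ nu * series u n)).
    by apply/cvg_lim => //; apply: cvgMl_tmp; exact: cu'.
  apply/funext => n; rewrite /series/= mulr_sumr; apply: eq_bigr => m _.
  rewrite powRD; last by rewrite (gt_eqF t2) implybT.
  rewrite -natrM powR_mulrn ?ltW// exprM -/z /u /bessel_coef.
  ring.
have cs := cvg_cauchy_sqr _ cu.
have JJ : pker 2 t * besselJ nu t ^+ 2 = (t * (t / 2) ^+ d) * limn (series u) ^+ 2.
  rewrite JE exprMn mulrA; congr (_ * _).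
  rewrite /pker t0 (_ : 2 - 1 = 1) ?powRr1 ?ltW//; last by ring.
  congr (_ * _); rewrite -(powR_mulrn 2 (powR_ge0 _ _)) -powRrM divfK//.
  by rewrite powR_mulrn// ltW.
have SE : series (fun N => (-1) ^+ N *
    (bessel_sqr_coef N * pker (2 + (d + 2 * N)%:R) t)) =
    (fun n => (t * (t / 2) ^+ d) * series (cauchy_sqr u) n); last first.
  by rewrite SE JJ; apply: cvgMl_tmp; exact: cs.
apply/funext => K; rewrite /series/= mulr_sumr; apply: eq_bigr => N _.
have -> : cauchy_sqr u N = (-1) ^+ N * z ^+ N * cauchy_sqr (bessel_coef nu) N.
  rewrite /cauchy_sqr mulr_sumr; apply: eq_bigr => i _; rewrite /u.
  have iN : (i <= N)%N by rewrite -ltnS.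
  move: (nat_of_ord i) iN => k kN.
  have [m ->] : exists m, N = (k + m)%N by exists (N - k)%N; rewrite subnKC.
  by rewrite !exprD addKn; ring.
rewrite /bessel_sqr_coef pkerDn {1}/pker t0 (_ : 2 - 1 = 1) ?powRr1 ?ltW//; last by ring.
have zE : (t / 2) ^+ d * z ^+ N = t ^+ (d + 2 * N) / 2 ^+ (d + 2 * N).
  by rewrite /z -exprM -exprD expr_div_n.
transitivity ((-1) ^+ N * cauchy_sqr (bessel_coef nu) N * t * ((t / 2) ^+ d * z ^+ N)).
  by rewrite zE; ring.
by ring.
Qed.

End bessel_square.

(** * Weber's integral and the Bessel integral *)

Section weber.
Context {R : realType} (d : nat).
Local Notation mu := (@lebesgue_measure R).
Local Notation T := (measurableTypeR R).
Local Notation nu := (d%:R / 2 : R).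
Local Notation h := (nu + 2^-1).
Implicit Types t x u : R.

(** [pker 2 t] is t on the half-line: the factor t is split off from t^(-1-s) = t * t^(-2-s), the
    rest being the Gaussian mixture. *)
Definition bessel_weight (t : T) : R := pker 2 t * besselJ nu t ^+ 2.

Lemma bessel_weight_ge0 t : 0 <= bessel_weight t.
Proof. by rewrite mulr_ge0 ?pker_ge0// sqr_ge0. Qed.

Lemma measurable_bessel_weight : measurable_fun setT bessel_weight.
Proof.
apply: (@measurable_alternating _ _ _ (fun N (t : T) => bessel_sqr_coef d N * pker (2 + (d + 2
    * N)%:R) t)).
  by move=> n; meas; exact: measurable_pker.
exact: cvg_bessel_sqr.
Qed.

Definition weber_weight (x : T) : R := pker h (1 - x) * pker h x.

Lemma weber_weight_ge0 x : 0 <= weber_weight x.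
Proof. by rewrite mulr_ge0 ?pker_ge0. Qed.

Lemma measurable_weber_weight : measurable_fun setT weber_weight.
Proof. by rewrite /weber_weight; meas; exact: measurable_pker. Qed.

(** The 2 comes from substituting t^2 in the Gaussian moments, sqrt(pi) from the duplication
    formula, and Gamma(h) is the factor that completes B(h+N, h). *)
Definition weber_const : R := (2 * Num.sqrt pi * Gamma h)^-1.

Let h0 : 0 < h. Proof. by rewrite ltr_wpDl ?invr_gt0// divr_ge0. Qed.

Lemma weber_const_ge0 : 0 <= weber_const.
Proof. by rewrite invr_ge0 !mulr_ge0 ?sqrtr_ge0// ltW// Gamma_gt0. Qed.

Section fixed_u.
Context (u : R).
Hypothesis u0 : 0 < u.
Let D := weber_const * u `^ (- (nu + 1)).
Let D0 : 0 <= D. Proof. by rewrite mulr_ge0 ?powR_ge0// weber_const_ge0. Qed.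
(** [f] lists the unsigned terms of the damped Bessel weight and [g] those of D exp(-x/u) times the
    Weber weight; [r] is the common value of their integrals, a Gaussian moment for [f] and a Beta
    integral for [g]. *)
Let f N (t : T) : R := expR (- (u * t `^ 2)) *
  (bessel_sqr_coef d N * pker (2 + (d + 2 * N)%:R) t).
Let g N (x : T) : R := D * ((x / u) ^+ N / N`!%:R * weber_weight x).
Let r N : R := D * (u ^- N / N`!%:R) * (Gamma (h + N%:R) * Gamma h / Gamma (2 * nu + N%:R + 1)).

Let nuN0 N : 0 < nu + N%:R + 1.
Proof. by rewrite ltr_wpDl// addr_ge0// divr_ge0. Qed.

Let mf N : measurable_fun setT (f N).
Proof. by rewrite /f; meas; exact: measurable_pker. Qed.

Let f0 N t : 0 <= f N t.
Proof.
by rewrite /f mulr_ge0 ?expR_ge0// mulr_ge0 ?pker_ge0// bessel_sqr_coef_ge0.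
Qed.

Let mg N : measurable_fun setT (g N).
Proof. by rewrite /g; have := measurable_weber_weight => mw; meas. Qed.

Let g0 N x : 0 <= g N x.
Proof.
rewrite /g; have [x0|x0] := ltP 0 x; last first.
  by rewrite /weber_weight [pker _ x]/pker ltNge x0 !mulr0.
apply: mulr_ge0 => //; apply: mulr_ge0; last exact: weber_weight_ge0.
by rewrite divr_ge0// exprn_ge0// divr_ge0// ltW.
Qed.

Let fr N : (\int[mu]_t (f N t)%:E = (r N)%:E)%E.
Proof.
transitivity ((bessel_sqr_coef d N)%:E * \int[mu]_t ((expR (- (u * t `^ 2)))%:E * (pker (2 + (d
    + 2 * N)%:R) t)%:E))%E.
  rewrite -ge0_integralZl_EFin ?bessel_sqr_coef_ge0//; last 2 first.
  - by move=> t _; rewrite mule_ge0// lee_fin ?expR_ge0// pker_ge0.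
  - by meas.
  by apply: eq_integral => t _; rewrite -!EFinM /f; congr EFin; ring.
rewrite (@mellin_powR _ 2 _ (fun y => (expR (- (u * y)))%:E))//; last by meas.
rewrite (_ : (2 + (d + 2 * N)%:R) / 2 = nu + N%:R + 1); last first.
  by rewrite natrD natrM; field.
rewrite integral_expR_pker// ger0_norm// -!EFinM; congr EFin.
transitivity (2^-1 * (bessel_sqr_coef d N * Gamma (nu + N%:R + 1)) * u `^ (- (nu + N%:R + 1))).
  by ring.
rewrite bessel_sqr_coefE /r /D /weber_const.
rewrite (_ : - (nu + N%:R + 1) = - (nu + 1) + (- N%:R)); last by ring.
rewrite powRD; last by rewrite (gt_eqF u0) implybT.
rewrite powR_invn ?(ltW u0)//.
have P1 : Num.sqrt pi != 0 :> R by rewrite gt_eqF// sqrtr_gt0 pi_gt0.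
have P2 : Gamma h != 0 by rewrite gt_eqF// Gamma_gt0.
have P3 : N`!%:R != 0 :> R by rewrite pnatr_eq0 -lt0n fact_gt0.
have P4 : Gamma (2 * nu + N%:R + 1) != 0.
  by rewrite gt_eqF// Gamma_gt0// ltr_wpDl// addr_ge0// mulr_ge0// divr_ge0.
have P5 : u ^+ N != 0 by rewrite expf_neq0// gt_eqF.
move: P1 P2 P3 P4 P5; generalize (u ^+ N); field_gamma.
Qed.

Let gr N : (\int[mu]_x (g N x)%:E = (r N)%:E)%E.
Proof.
transitivity ((D * (u ^- N / N`!%:R))%:E * betaE (h + N%:R) h)%E.
  rewrite /betaE -ge0_integralZl_EFin//; last 3 first.
  - by move=> x _; rewrite mule_ge0// lee_fin pker_ge0.
  - by meas.
  - by apply: mulr_ge0 => //; rewrite divr_ge0// invr_ge0 exprn_ge0// ltW.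
  apply: eq_integral => x _; rewrite -!EFinM /g /weber_weight pkerDn expr_div_n.
  by congr EFin; ring.
have hN : 0 < h + N%:R by apply: ltr_wpDr.
rewrite (betaE_Gamma _ _ hN h0).
rewrite -EFinM /r (_ : h + N%:R + h = 2 * nu + N%:R + 1)//.
by field.
Qed.

(** Summability is read off from [g] instead of [f]: its unsigned sum is D exp(x/u) times a weight
    supported in (0,1), at most exp(1/u) times an integrable function. *)
Let rfin : (\sum_(0 <= n <oo) (r n)%:E < +oo)%E.
Proof.
rewrite (eq_eseriesr (g := fun n => \int[mu]_x (g n x)%:E)%E); last by move=> n _; rewrite gr.
rewrite -integral_nneseries//; last 2 first.
- by move=> n; apply/measurable_EFinP.
- by move=> n x _; rewrite lee_fin.
apply: (@le_lt_trans _ _ ((D * expR (u^-1))%:E * betaE h h)%E); last first.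
  by rewrite betaE_Gamma// -EFinM ltry.
rewrite /betaE -ge0_integralZl_EFin//; last 3 first.
- by move=> x _; rewrite mule_ge0// lee_fin pker_ge0.
- by meas.
- by rewrite mulr_ge0// expR_ge0.
apply: ge0_le_integral => //.
- by move=> x _; apply: nneseries_ge0 => n _ _; rewrite lee_fin.
- apply: ge0_emeasurable_sum => [n x _ _|n _]; first by rewrite lee_fin.
  exact/measurable_EFinP.
- by meas.
move=> x _; have [x0|x0] := ltP 0 x; last first.
  rewrite eseries0; first by rewrite [pker _ x]/pker ltNge x0 !mule0.
  by move=> n _ _; rewrite /g /weber_weight [pker _ x]/pker ltNge x0 !mulr0.
have xu0 : 0 <= x / u by rewrite divr_ge0// ltW.
rewrite (eq_eseriesr (g := fun n => (D * weber_weight x)%:E * ((x / u) ^+ n / n`!%:R)%:E)%E);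
    last first.
  by move=> n _; rewrite /g -EFinM; congr EFin; ring.
rewrite nneseriesZl; last by move=> n _; rewrite lee_fin divr_ge0// exprn_ge0.
rewrite nneseries_expR// -!EFinM lee_fin /weber_weight.
have [x1|x1] := ltP x 1; last first.
  by rewrite [pker _ (1 - x)]/pker subr_gt0 ltNge x1 !(mul0r, mulr0).
rewrite mulrAC ler_wpM2r//; first by rewrite mulr_ge0// pker_ge0.
rewrite ler_wpM2l// ler_expR -[leRHS]mul1r ler_wpM2r ?invr_ge0// ltW//.
Qed.

Lemma weber_integral :
  (\int[mu]_t ((expR (- (u * t `^ 2)))%:E * (bessel_weight t)%:E) =
   D%:E * \int[mu]_x ((expR (- (x / u)))%:E * (weber_weight x)%:E))%E.
Proof.
have H1 := @cvg_integral_alternating _ _ _ mu f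
  (fun t => expR (- (u * t `^ 2)) * bessel_weight t) r mf f0 _ fr rfin.
have H2 := @cvg_integral_alternating _ _ _ mu g
  (fun x => D * (expR (- (x / u)) * weber_weight x)) r mg g0 _ gr rfin.
rewrite -ge0_integralZl_EFin//; last 2 first.
- by move=> x _; rewrite mule_ge0// lee_fin ?expR_ge0 ?weber_weight_ge0.
- by have := measurable_weber_weight => mw; meas.
transitivity (\int[mu]_x (D * (expR (- (x / u)) * weber_weight x))%:E)%E; last first.
  by apply: eq_integral => x _; rewrite -!EFinM.
transitivity (\int[mu]_t (expR (- (u * t `^ 2)) * bessel_weight t)%:E)%E.
  by apply: eq_integral => x _; rewrite -!EFinM.
apply: (cvg_unique _ (H1 _) (H2 _)) => //.
- move=> t.
  rewrite (_ : series _ = (fun n => expR (- (u * t `^ 2)) * series (fun N => (-1) ^+ N *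
      (bessel_sqr_coef d N * pker (2 + (d + 2 * N)%:R) t)) n)).
    apply: cvgMl_tmp; exact: cvg_bessel_sqr.
  by apply/funext => n; rewrite /series/= mulr_sumr; apply: eq_bigr => i _; rewrite /f; ring.
- move=> x.
  rewrite (_ : series _ = (fun n => (D * weber_weight x) * series (exp_coeff (- (x / u))) n)).
    rewrite [X in _ --> X](_ : _ = D * weber_weight x * expR (- (x / u))); last by ring.
    apply: cvgMl_tmp; exact: is_cvg_series_exp_coeff.
  apply/funext => n; rewrite /series/= mulr_sumr; apply: eq_bigr => i _; rewrite /g /exp_coeff /=.
  by rewrite (exprNn (x / u)); ring.
Qed.

End fixed_u.

Lemma bessel_integralE s : 0 < s -> s < d%:R ->
  (\int[mu]_(t in `]0%R, +oo[) (besselJ nu t ^+ 2 / t `^ (1 + s))%:E)%E =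
  (Gamma ((d%:R - s) / 2) * Gamma ((s + 1) / 2) /
   (2 * Num.sqrt pi * Gamma (s / 2 + 1) * Gamma ((d%:R + s) / 2 + 1)))%:E.
Proof.
move=> s0 sd.
have mB := measurable_bessel_weight.
have mW := measurable_weber_weight.
have G0 : 0 < Gamma (s / 2 + 1) by rewrite Gamma_gt0// addr_gt0// divr_gt0.
(* Integrating u^(s/2) exp(-u t^2) over u > 0 gives Gamma(s/2+1) t^(-2-s); here z is the pair (t,
   u). *)
pose F (z : T * T) : \bar R :=
  ((expR (- (z.2 * z.1 `^ 2)))%:E * (bessel_weight z.1)%:E * (pker (s / 2 + 1) z.2)%:E)%E.
have mF : measurable_fun setT F by rewrite /F; meas.
have F0 z : (0 <= F z)%E.
  by rewrite /F !mule_ge0// lee_fin ?expR_ge0 ?bessel_weight_ge0 ?pker_ge0.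
(* Here z is the pair (u, x), and u^(s/2) has been combined with the factor u^(-d/2-1) of the Weber
   formula. The quotient x/u is written with a real power so that inverting u is an instance of
   [mellin_powR]. *)
pose H (z : T * T) : \bar R :=
  ((expR (- (z.2 * z.1 `^ (-1))))%:E * (weber_weight z.2)%:E * (pker (s / 2 - nu) z.1)%:E)%E.
have mH : measurable_fun setT H by rewrite /H; meas.
have H0 z : (0 <= H z)%E.
  by rewrite /H !mule_ge0// lee_fin ?expR_ge0 ?weber_weight_ge0 ?pker_ge0.
have mFt : measurable_fun setT (fun t => \int[mu]_u F (t, u))%E.
  exact: (measurable_fun_fubini_tonelli_F F mF F0).
have mHu : measurable_fun setT (fun u => \int[mu]_x H (u, x))%E.
  exact: (measurable_fun_fubini_tonelli_F H mH H0).
have Gi0 : 0 <= (Gamma (s / 2 + 1))^-1 by rewrite invr_ge0 ltW.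
transitivity ((Gamma (s / 2 + 1))^-1%:E * \int[mu]_t \int[mu]_u F (t, u))%E.
  rewrite -ge0_integralZl_EFin; [|by []|by move=> t _; exact: integral_ge0|exact: mFt|exact: Gi0].
  rewrite [LHS]integral_mkcond; apply: eq_integral => t _.
  rewrite patchE mem_setE/= in_itv/= andbT; case: ifPn => t0; last first.
    rewrite integral0_eq ?mule0// => u _.
    by rewrite /F/= /bessel_weight [pker 2 t]/pker (negbTE t0) mul0r mule0 mul0e.
  have t20 : 0 < t `^ 2 by exact: powR_gt0.
  transitivity ((Gamma (s / 2 + 1))^-1%:E * ((bessel_weight t)%:E *
     \int[mu]_u ((expR (- (t `^ 2 * u)))%:E * (pker (s / 2 + 1) u)%:E)))%E.
    rewrite integral_expR_pker ?addr_gt0 ?divr_gt0// -!EFinM; congr EFin.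
    rewrite /bessel_weight /pker t0 -powRrM.
    have -> : t `^ (2 * - (s / 2 + 1)) = (t `^ (1 + s))^-1 / t.
      rewrite -powRN -powR_inv1 ?(ltW t0)// -powRD; last by rewrite (gt_eqF t0) implybT.
      by congr (_ `^ _); field.
    rewrite (_ : 2 - 1 = 1) ?powRr1 ?(ltW t0)//; last by ring.
    have P1 := lt0r_neq0 t0.
    have P2 : t `^ (1 + s) != 0 by rewrite gt_eqF// powR_gt0.
    have P3 := lt0r_neq0 G0.
    by field; rewrite P1 P2 P3.
  rewrite -ge0_integralZl_EFin ?bessel_weight_ge0//; last 2 first.
  - by move=> u _; rewrite mule_ge0// lee_fin ?expR_ge0 ?pker_ge0.
  - by meas.
  by congr (_ * _)%E; apply: eq_integral => u _; rewrite /F/= mulrC muleCA muleA.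
rewrite fubini_tonelli//.
transitivity ((Gamma (s / 2 + 1))^-1%:E * (weber_const%:E * \int[mu]_u \int[mu]_x H (u, x)))%E.
  congr (_ * _)%E.
  rewrite -ge0_integralZl_EFin ?weber_const_ge0//; last by move=> t _; exact: integral_ge0.
  apply: eq_integral => u _; have [u0|u0] := ltP 0 u; last first.
    rewrite !integral0_eq ?mule0// => x _.
      by rewrite /H/= [pker _ u]/pker ltNge u0 mule0.
    by rewrite /F/= [pker _ u]/pker ltNge u0 mule0.
  rewrite /F/= ge0_integralZr//; last 3 first.
  - by meas.
  - by move=> t _; rewrite mule_ge0// lee_fin ?expR_ge0 ?bessel_weight_ge0.
  - by rewrite lee_fin pker_ge0.
  rewrite weber_integral// /H/= ge0_integralZr//; last 3 first.
  - by meas.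
  - by move=> t _; rewrite mule_ge0// lee_fin ?expR_ge0 ?weber_weight_ge0.
  - by rewrite lee_fin pker_ge0.
  under [in RHS]eq_integral do rewrite powR_inv1 ?(ltW u0)//.
  rewrite (_ : s / 2 - nu = (s / 2 + 1) + - (nu + 1)); last by ring.
  by rewrite (pkerM (s / 2 + 1))// !EFinM -!muleA; congr (_ * _)%E; rewrite muleCA.
rewrite fubini_tonelli//.
(* This is the parameter of the Gamma integral in 1/u; its positivity is the condition s < d. *)
have ns0 : 0 < nu - s / 2 by lra.
have GE0 := ltW (Gamma_gt0 _ ns0).
transitivity ((Gamma (s / 2 + 1))^-1%:E * (weber_const%:E * ((Gamma (nu - s / 2))%:E * betaE
    ((s + 1) / 2) h)))%E.
  congr (_ * (_ * _))%E; rewrite /betaE -ge0_integralZl_EFin//; last 2 first.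
  - by move=> t _; rewrite mule_ge0// lee_fin pker_ge0.
  - by meas.
  apply: eq_integral => x _; have [x0|x0] := ltP 0 x; last first.
    rewrite [pker _ x]/pker ltNge x0 !mule0 integral0_eq// => u _.
    by rewrite /H/= /weber_weight [pker _ x]/pker ltNge x0 mulr0 mule0 mul0e.
  transitivity ((weber_weight x)%:E * \int[mu]_u ((expR (- (x * u `^ (-1))))%:E * (pker (s / 2
      - nu) u)%:E))%E.
    rewrite -ge0_integralZl_EFin ?weber_weight_ge0//; last 2 first.
    - by move=> u _; rewrite mule_ge0// lee_fin ?expR_ge0 ?pker_ge0.
    - by meas.
    by apply: eq_integral => u _; rewrite /H/= -muleA muleCA.
  rewrite (@mellin_powR _ (-1) _ (fun y => (expR (- (x * y)))%:E))//; last by meas.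
  rewrite (_ : (s / 2 - nu) / -1 = nu - s / 2); last by rewrite invrN1; ring.
  rewrite integral_expR_pker// normrN1 invr1 mul1e -!EFinM; congr EFin.
  (* The Gamma integral contributes x^(s/2-d/2), which changes the Beta parameter at 0 from h to
     (s+1)/2. *)
  rewrite /weber_weight (_ : (s + 1) / 2 = h + - (nu - s / 2)); last by field.
  by rewrite (pkerM h)//; ring.
rewrite betaE_Gamma//; last by rewrite divr_gt0// addr_gt0.
rewrite -!EFinM; congr EFin; rewrite /weber_const.
rewrite (_ : (d%:R - s) / 2 = nu - s / 2); last by field.
rewrite (_ : (s + 1) / 2 + h = (d%:R + s) / 2 + 1); last by field.
have P1 : Num.sqrt pi != 0 :> R by rewrite gt_eqF// sqrtr_gt0 pi_gt0.
have P2 := lt0r_neq0 (Gamma_gt0 _ h0).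
have P3 := lt0r_neq0 G0.
have P4 : Gamma ((d%:R + s) / 2 + 1) != 0.
  by apply: lt0r_neq0; apply: Gamma_gt0; rewrite addr_gt0// divr_gt0// ltr_wpDl.
move: P1 P2 P3 P4; field_gamma.
Qed.

End weber.

(** * Lebesgue measure on tuples: rotations and polar coordinates *)

Section planar.
Context {R : realType}.
Local Notation mu := (@lebesgue_measure R).
Local Notation T := (measurableTypeR R).
Implicit Types (a b c : R).
Local Open Scope ereal_scope.

Lemma ge0_integral_affine_neq0 c e (F : T -> \bar R) : (c != 0)%R ->
  measurable_fun setT F -> (forall x, 0 <= F x) ->
  \int[mu]_x F x = (`|c|)%:E * \int[mu]_x F (c * x + e)%R.
Proof.
move=> c0 mF F0; have n0 : (0 < `|c|)%R by rewrite normr_gt0.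
have H : \int[mu]_x F (c * x + e)%R = \int[mu]_x F (`|c| * x + e)%R.
  have [cge0|clt0] := leP 0%R c; first by rewrite ger0_norm.
  rewrite -[LHS](@ge0_integralN _ (fun x => F (c * x + e)%R))//; last by meas.
  by apply: eq_integral => x _; rewrite mulrN ltr0_norm// mulNr.
by rewrite H ge0_integral_affine// muleA -EFinM divff ?gt_eqF// mul1e.
Qed.

Lemma ge0_integral_even (G : T -> \bar R) :
  measurable_fun setT G -> (forall x, 0 <= G x) ->
  \int[mu]_x G `|x|%R = 2%:E * \int[mu]_x (G x * (pker 1 x)%:E).
Proof.
move=> mG G0.
have mn : measurable_fun setT (fun x : T => `|x|%R : T) by exact: normr_measurable.
have mGn : measurable_fun setT (fun x : T => G `|x|%R) by exact: measurableT_comp.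
transitivity (\int[mu]_(x in (`]0%R, +oo[ : set T) `|` ~` `]0%R, +oo[) G `|x|%R).
  by rewrite setUv.
rewrite ge0_integral_setU//; last 3 first.
- exact: measurableC.
- by rewrite setUv.
- by apply/disj_setPS => x [].
have H : \int[mu]_(x in `]0%R, +oo[) G `|x|%R = \int[mu]_x (G x * (pker 1 x)%:E).
  rewrite integral_pker_itv subrr; apply: eq_integral => x.
  rewrite inE/= in_itv/= andbT => x0.
  by rewrite powRr0 mule1 gtr0_norm.
rewrite H (_ : ~` _ = `]-oo, 0%R]%classic); last first.
  by apply/seteqP; split => x /=; rewrite !in_itv/= andbT leNgt => /negP.
have -> : \int[mu]_(x in `]-oo, 0%R]) G `|x|%R =
    \int[mu]_(x in `]-oo, 0%R]) (fun y => G `|y|%R) (- (- x))%R.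
  by apply: eq_integral => x _; rewrite opprK.
under [X in _ + X]eq_integral do rewrite opprK -normrN.
rewrite -[X in _ + X](@ge0_integration_by_substitution0 _ (fun y : T => G `|y|%R))//.
rewrite -integral_itv_obnd_cbnd; last exact: measurable_funTS.
by rewrite H (_ : 2%:E = 1 + 1)%E// ge0_muleDl// mul1e.
Qed.

(** Polar coordinates in dimension one, used for each new coordinate in higher dimension. *)
Lemma ge0_integral_sq (K : T -> \bar R) :
  measurable_fun setT K -> (forall x, 0 <= K x) ->
  \int[mu]_x K (x ^+ 2)%R = \int[mu]_y (K y * (pker 2^-1 y)%:E).
Proof.
move=> mK K0.
transitivity (\int[mu]_x K (`|x| `^ 2)%R).
  by apply: eq_integral => x _; rewrite powR_mulrn// real_normK// num_real.
rewrite (@ge0_integral_even (fun x => K (x `^ 2)%R))//; last by meas.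
rewrite mellin_powR// muleA -EFinM ger0_norm// divff// mul1e.
by apply: eq_integral => x _; rewrite div1r.
Qed.

(* The rotation is the product of two affine substitutions in one variable, with
   Jacobians rho / b and b / rho. *)
Lemma planar_rotation a b (F : T * T -> \bar R) :
  measurable_fun setT F -> (forall x, 0 <= F x) ->
  \int[mu]_x \int[mu]_y F (x ^+ 2 + y ^+ 2, a * x + b * y)%R =
  \int[mu]_x \int[mu]_y F (x ^+ 2 + y ^+ 2, Num.sqrt (a ^+ 2 + b ^+ 2) * x)%R.
Proof.
move=> mF F0; set rho := Num.sqrt _.
have mFp (U V : T * T -> T) : measurable_fun setT U -> measurable_fun setT V ->
    measurable_fun setT (fun z => F (U z, V z)).
  by move=> mU mV; apply: (measurableT_comp mF); exact: measurable_fun_pair.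
have rhoE : (rho ^+ 2 = a ^+ 2 + b ^+ 2)%R by rewrite sqr_sqrtr// addr_ge0// sqr_ge0.
(* The substitutions below divide by b; when b = 0 at most a reflection in x is needed. *)
have [b0|bn0] := eqVneq b 0%R.
  have mG c : measurable_fun setT (fun x : T => \int[mu]_y F (x ^+ 2 + y ^+ 2, c * x)%R).
    apply: (measurable_fun_fubini_tonelli_F (fun z : T * T => F (z.1 ^+ 2 + z.2 ^+ 2, c *
        z.1)%R)) => //.
    by apply: mFp; meas.
  have -> : rho = `|a|%R by rewrite /rho b0 expr0n addr0 sqrtr_sqr.
  transitivity (\int[mu]_x \int[mu]_y F (x ^+ 2 + y ^+ 2, a * x)%R).
    apply: eq_integral => x _; apply: eq_integral => y _.
    by rewrite b0 mul0r addr0.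
  have [a0|a0] := leP 0%R a; first by rewrite ger0_norm.
  rewrite (ltr0_norm a0) -[LHS](ge0_integralN (fun x => \int[mu]_y F (x ^+ 2 + y ^+ 2, a *
      x)%R) (mG a)); last first.
    by move=> x; exact: integral_ge0.
  by apply: eq_integral => x _; apply: eq_integral => y _; rewrite sqrrN mulrN mulNr.
have rho0 : (0 < rho)%R.
  by rewrite sqrtr_gt0 ltr_wpDl ?sqr_ge0// exprn_even_gt0.
pose c := (rho / b)%R.
have rn0 : (rho != 0)%R by rewrite gt_eqF.
have c0 : (c != 0)%R by apply: mulf_neq0 => //; rewrite invr_eq0.
(* y is replaced by c w - (a/b) x, chosen so that a x + b y = rho w. *)
pose G (z : T * T) := F (z.1 ^+ 2 + (c * z.2 - a / b * z.1) ^+ 2, rho * z.2)%R.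
have mG : measurable_fun setT G by apply: mFp; meas.
have G0 z : 0 <= G z by exact: F0.
transitivity (\int[mu]_x ((`|c|)%:E * \int[mu]_w G (x, w))).
  apply: eq_integral => x _.
  rewrite (@ge0_integral_affine_neq0 c (- (a / b * x)))//; last first.
    apply: (measurableT_comp mF); apply: measurable_fun_pair; meas.
  congr (_ * _); apply: eq_integral => w _; rewrite /G/=; congr (F (_, _)).
  by rewrite /c; field.
rewrite ge0_integralZl_EFin//; last 2 first.
- by move=> x _; exact: integral_ge0.
- exact: measurable_fun_fubini_tonelli_F.
rewrite fubini_tonelli// -ge0_integralZl_EFin//; last 2 first.
- by move=> x _; exact: integral_ge0.
- exact: (measurable_fun_fubini_tonelli_G G).
apply: eq_integral => w _.
rewrite (@ge0_integral_affine_neq0 (b / rho) (a / rho * w) (fun x => G (x, w)))//; last 2 first.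
- by apply: mulf_neq0 => //; rewrite invr_eq0.
- by rewrite /G/=; apply: (measurableT_comp mF); apply: measurable_fun_pair; meas.
rewrite muleA -EFinM -normrM (_ : c * (b / rho) = 1)%R; last first.
  by rewrite /c; field; rewrite rn0 bn0.
rewrite normr1 mul1e.
apply: eq_integral => v _; rewrite /G/=; congr (F (_, _)).
have b2 : (b ^+ 2 = rho ^+ 2 - a ^+ 2)%R by rewrite rhoE addrC addKr.
have -> : ((rho / b) * w - a / b * (b / rho * v + a / rho * w) = (b * w - a * v) / rho)%R.
  apply: (mulfI bn0); apply: (mulfI rn0).
  transitivity ((rho ^+ 2 - a ^+ 2) * w - a * b * v)%R; first by field; rewrite rn0 bn0.
  by rewrite -b2; field.
transitivity ((a ^+ 2 + b ^+ 2) / rho ^+ 2 * (w ^+ 2 + v ^+ 2))%R; first by field.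
by rewrite -rhoE divff ?expf_neq0// mul1r.
Qed.

End planar.

Section tuple_geometry.
Context {R : realType}.
Local Notation mu := (@lebesgue_measure R).
Local Notation T := (measurableTypeR R).
Local Notation leb n := (@lebesgue_tuple R n).
Implicit Types (c : R).

Definition dot n (v w : n.-tuple T) : R := \sum_(i < n) tnth v i * tnth w i.
Definition sqnorm n (v : n.-tuple T) : R := dot n v v.
Definition tadd n (v w : n.-tuple T) : n.-tuple T :=
  [tuple tnth v i + tnth w i | i < n].
Definition tcons n (x : T) (v : n.-tuple T) : n.+1.-tuple T := [tuple of x :: v].

Lemma dot_cons n x y (v w : n.-tuple T) :
  dot n.+1 (tcons n x v) (tcons n y w) = x * y + dot n v w.
Proof.
rewrite /dot big_ord_recl !tnth0; congr (_ + _).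
by apply: eq_bigr => i _; rewrite !tnthS.
Qed.

Lemma sqnorm_cons n x (v : n.-tuple T) :
  sqnorm n.+1 (tcons n x v) = x ^+ 2 + sqnorm n v.
Proof. by rewrite /sqnorm dot_cons expr2. Qed.

Lemma tadd_cons n x y (v w : n.-tuple T) :
  tadd n.+1 (tcons n x v) (tcons n y w) = tcons n (x + y) (tadd n v w).
Proof.
apply: eq_from_tnth => i; rewrite tnth_mktuple.
have [j ->|->] := unliftP ord0 i; last by rewrite !tnth0.
by rewrite !tnthS tnth_mktuple.
Qed.

Lemma sqnorm_ge0 n (v : n.-tuple T) : 0 <= sqnorm n v.
Proof. by apply: sumr_ge0 => i _; rewrite -expr2 sqr_ge0. Qed.

Lemma sqnorm_add n (v w : n.-tuple T) :
  sqnorm n (tadd n v w) = sqnorm n v + 2 * dot n v w + sqnorm n w.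
Proof.
rewrite /sqnorm /dot mulr_sumr -!big_split/=; apply: eq_bigr => i _.
by rewrite tnth_mktuple; ring.
Qed.

Lemma tcons_tnth n (v : n.+1.-tuple T) : exists x w, v = tcons n x w.
Proof. by exists (thead v), [tuple of behead v]; exact: tuple_eta. Qed.

Lemma measurable_dot n d (U : measurableType d) (f g : U -> n.-tuple T) :
  measurable_fun setT f -> measurable_fun setT g ->
  measurable_fun setT (fun x => dot n (f x) (g x)).
Proof.
move=> mf mg; rewrite /dot; apply: measurable_sum => i.
by apply: measurable_funM; [exact: (measurableT_comp (@measurable_tnth _ T n i) mf)|exact:
    (measurableT_comp (@measurable_tnth _ T n i) mg)].
Qed.

Lemma measurable_sqnorm n : measurable_fun setT (@sqnorm n).
Proof. exact: measurable_dot. Qed.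

Lemma measurable_tcons n d (U : measurableType d) (f : U -> T) (g : U -> n.-tuple T) :
  measurable_fun setT f -> measurable_fun setT g ->
  measurable_fun setT (fun x => tcons n (f x) (g x)).
Proof.
move=> mf mg.
exact: (measurable_cons mf mg).
Qed.

Lemma measurable_tadd n d (U : measurableType d) (f g : U -> n.-tuple T) :
  measurable_fun setT f -> measurable_fun setT g ->
  measurable_fun setT (fun x => tadd n (f x) (g x)).
Proof.
move=> mf mg; apply/measurable_fun_tnthP => i.
rewrite (_ : _ \o _ = (fun x => tnth (f x) i + tnth (g x) i)); last first.
  by apply/funext => x /=; rewrite tnth_mktuple.
by apply: measurable_funD; [exact: (measurableT_comp (@measurable_tnth _ T n i) mf)|exact:
    (measurableT_comp (@measurable_tnth _ T n i) mg)].
Qed.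

Local Open Scope ereal_scope.

Lemma ge0_integral_tuple0 (F : 0.-tuple T -> \bar R) :
  measurable_fun setT F -> (forall v, 0 <= F v) ->
  \int[leb 0%N]_v F v = F [tuple].
Proof. by move=> mF F0; rewrite integral_dirac// diracT mul1e. Qed.

Lemma ge0_integral_tupleS n (F : n.+1.-tuple T -> \bar R) :
  measurable_fun setT F -> (forall v, 0 <= F v) ->
  \int[leb n.+1]_v F v = \int[mu]_x \int[leb n]_v F (tcons n x v).
Proof.
move=> mF F0.
have mc : measurable_fun setT (fun p : T * n.-tuple T => tcons n p.1 p.2).
  exact: measurable_tcons.
have mFc : measurable_fun setT (fun p : T * n.-tuple T => F (tcons n p.1 p.2)).
  exact: (measurableT_comp mF).
rewrite -[RHS](@fubini_tonelli1 _ _ _ _ R mu (leb n) (fun p => F (tcons n p.1 p.2)))//.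
exact: (@ge0_integral_pushforward _ _ _ _ R _ mc (mu \x leb n)%E setT F).
Qed.

End tuple_geometry.

Section tuple_integrals.
Context {R : realType}.
Local Notation mu := (@lebesgue_measure R).
Local Notation T := (measurableTypeR R).
Local Notation leb n := (@lebesgue_tuple R n).
Implicit Types (c : R).
Local Open Scope ereal_scope.

Lemma ge0_integral_tadd n (w : n.-tuple T) (F : n.-tuple T -> \bar R) :
  measurable_fun setT F -> (forall v, 0 <= F v) ->
  \int[leb n]_v F (tadd n v w) = \int[leb n]_v F v.
Proof.
elim: n w F => [|n IH] w F mF F0.
  by apply: eq_integral => v _; congr F; apply: eq_from_tnth => -[].
have mFt (x : T) : measurable_fun setT (fun v => F (tcons n x v)).
  by apply: (measurableT_comp mF); exact: measurable_tcons.
have [y [w' ->]] := tcons_tnth n w.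
have mFa : measurable_fun setT (fun v => F (tadd n.+1 v (tcons n y w'))).
  by apply: (measurableT_comp mF); exact: measurable_tadd.
rewrite (ge0_integral_tupleS n _ mF F0) (ge0_integral_tupleS n _ mFa (fun v => F0 _)).
rewrite -[RHS](@ge0_integral_shift _ y (fun x => \int[leb n]_v F (tcons n x v))).
- apply: eq_integral => x _.
  rewrite -[RHS](IH w')//.
  by apply: eq_integral => v _; rewrite tadd_cons.
- apply: (measurable_fun_fubini_tonelli_F (fun z : T * n.-tuple T => F (tcons n z.1 z.2))) => //.
  by apply: (measurableT_comp mF); exact: measurable_tcons.
- by move=> x; exact: integral_ge0.
Qed.

(** Half the area of the unit sphere of R^n; the half is due to using t = r^2 in place of r. *)
Definition polar_const n : R := (Num.sqrt pi ^+ n / Gamma (n%:R / 2))%R.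

Lemma polar_const_ge0 n : (0 < n)%N -> (0 <= polar_const n)%R.
Proof.
move=> n0; apply: divr_ge0; first by rewrite exprn_ge0// sqrtr_ge0.
by apply: ltW; apply: Gamma_gt0; rewrite divr_gt0// ltr0n.
Qed.

(** Splitting off a coordinate x makes the squared norm a sum x^2 + t. By induction both summands
    carry power densities, of parameters 1/2 and (dimension)/2, and [mellin_conv] adds the
    parameters; its Beta factor updates the constant. *)
Lemma integral_polar n (h : T -> \bar R) :
  measurable_fun setT h -> (forall x, 0 <= h x) ->
  \int[leb n.+1]_v h (sqnorm n.+1 v) =
  (polar_const n.+1)%:E * \int[mu]_t (h t * (pker (n.+1%:R / 2)%R t)%:E).
Proof.
elim: n h => [|n IH] h mh h0; rewrite ge0_integral_tupleS//; try
  (by apply: (measurableT_comp mh); exact: measurable_sqnorm).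
  rewrite /polar_const expr1 div1r Gamma_half divff; last first.
    by rewrite gt_eqF// sqrtr_gt0 pi_gt0.
  rewrite mul1e -ge0_integral_sq//; apply: eq_integral => x _.
  rewrite ge0_integral_tuple0//; last first.
    apply: (measurableT_comp mh); apply: (measurableT_comp (measurable_sqnorm 1)).
    exact: measurable_tcons.
  by rewrite sqnorm_cons /sqnorm /dot big_ord0 addr0.
pose a : R := (n.+1%:R / 2)%R.
have a0 : (0 < a)%R by rewrite divr_gt0.
pose K (y : T) := (polar_const n.+1)%:E * \int[mu]_t (h (y + t)%R * (pker a t)%:E).
have mhK : measurable_fun setT (fun z : T * T => h (z.1 + z.2)%R * (pker a z.2)%:E) by meas.
have hK0 z : 0 <= (fun z : T * T => h (z.1 + z.2)%R * (pker a z.2)%:E) z.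
  by rewrite mule_ge0// lee_fin pker_ge0.
have mK : measurable_fun setT K.
  rewrite /K; meas; exact: (measurable_fun_fubini_tonelli_F _ mhK hK0).
have K0 x : 0 <= K x.
  rewrite /K mule_ge0 ?lee_fin ?polar_const_ge0//.
  by apply: integral_ge0 => t _; rewrite mule_ge0// lee_fin pker_ge0.
transitivity (\int[mu]_x K (x ^+ 2)%R).
  apply: eq_integral => x _; rewrite /K -(IH (fun t => h (x ^+ 2 + t)%R))//; last by meas.
  by apply: eq_integral => v _; rewrite sqnorm_cons.
rewrite ge0_integral_sq// /K.
under eq_integral do rewrite -muleA.
have mI : measurable_fun setT (fun y : T => \int[mu]_t (h (y + t)%R * (pker a t)%:E)).
  exact: (measurable_fun_fubini_tonelli_F _ mhK hK0).
rewrite (@ge0_integralZl_EFin _ _ _ mu setT measurableT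
  (fun y => (\int[mu]_t (h (y + t)%R * (pker a t)%:E)) * (pker 2^-1 y)%:E)); last 3 first.
- move=> x _; rewrite mule_ge0 ?lee_fin ?pker_ge0//.
  by apply: integral_ge0 => t _; rewrite mule_ge0// lee_fin pker_ge0.
- by meas.
- exact: polar_const_ge0.
transitivity ((polar_const n.+1)%:E * (betaE 2^-1 a * \int[mu]_x (h x * (pker (2^-1 + a) x)%:E))).
  congr (_ * _); rewrite -mellin_conv//; apply: eq_integral => y _.
  rewrite ge0_integralZr//; last 3 first.
  - by meas.
  - by move=> t _; rewrite mule_ge0// lee_fin pker_ge0.
  - by rewrite lee_fin pker_ge0.
have i20 : (0 < 2^-1 :> R)%R by rewrite invr_gt0.
rewrite (betaE_Gamma _ _ i20 a0) muleA -EFinM Gamma_half.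
have -> : (2^-1 + a = n.+2%:R / 2)%R by rewrite /a -[n.+2%:R]natr1; field.
congr (_%:E * _); rewrite /polar_const [in RHS]exprS.
have := lt0r_neq0 (Gamma_gt0 a a0); rewrite /a.
have : (Gamma (n.+2%:R / 2) != 0 :> R)%R by apply: lt0r_neq0; apply: Gamma_gt0; rewrite divr_gt0.
generalize (Num.sqrt (pi : R) ^+ n.+1)%R.
by field_gamma.
Qed.

Definition ball_const n : R := (Num.sqrt pi ^+ n / Gamma (n%:R / 2 + 1))%R.

Lemma ball_const_ge0 n : (0 <= ball_const n)%R.
Proof.
apply: divr_ge0; first by rewrite exprn_ge0// sqrtr_ge0.
by apply: ltW; apply: Gamma_gt0; rewrite ltr_wpDl// divr_ge0.
Qed.

(** [c] is the squared radius. Negative c (empty ball) and n = 0 (a point) are included because both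
    occur for slices of balls. *)
Lemma integral_ball n c :
  \int[leb n]_v (pker 1 (c - sqnorm n v))%:E =
  (ball_const n * pker (n%:R / 2 + 1) c)%:E.
Proof.
case: n => [|n].
  rewrite ge0_integral_tuple0//; last 2 first.
  - by have := @measurable_sqnorm R 0 => ms; meas.
  - by move=> v; rewrite lee_fin pker_ge0.
  rewrite /sqnorm /dot big_ord0 subr0 /ball_const expr0 mul0r add0r Gamma1.
  by rewrite divr1 mul1r.
rewrite (integral_polar n (fun t => (pker 1 (c - t))%:E)); last 2 first.
- by meas.
- by move=> t; rewrite lee_fin pker_ge0.
have n0 : (0 < n.+1%:R / 2 :> R)%R by rewrite divr_gt0.
rewrite integral_pker_pker betaEa1// -!EFinM; congr EFin.
rewrite /polar_const /ball_const (GammaS _ n0).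
have := lt0r_neq0 n0.
have := lt0r_neq0 (Gamma_gt0 _ n0).
generalize (n.+1%:R / 2 : R)%R => q.
generalize (Num.sqrt (pi : R) ^+ n.+1)%R (Gamma q) => A G H1 H2.
by rewrite mulrA mulrAC; congr (_ * _)%R; field; rewrite H1 H2.
Qed.

(** By induction the tail of v is rotated so that its product with the tail of z becomes b y, with b
    the norm of that tail; a rotation in the plane of x and y then aligns (a, b) with the first
    axis. *)
Lemma rotation n (z : n.+1.-tuple T) (F : T * T -> \bar R) :
  measurable_fun setT F -> (forall x, 0 <= F x) ->
  \int[leb n.+1]_v F (sqnorm n.+1 v, dot n.+1 v z) =
  \int[mu]_x \int[leb n]_w F (x ^+ 2 + sqnorm n w, Num.sqrt (sqnorm n.+1 z) * x)%R.
Proof.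
have mFpair d (U : measurableType d) (f g : U -> T) : measurable_fun setT f ->
    measurable_fun setT g -> forall G : T * T -> \bar R, measurable_fun setT G ->
    measurable_fun setT (fun x => G (f x, g x)).
  by move=> mf mg G mG; apply: (measurableT_comp mG); exact: measurable_fun_pair.
have msq k d (U : measurableType d) (f : U -> k.-tuple T) :
    measurable_fun setT f -> measurable_fun setT (fun x => sqnorm k (f x) : T).
  by move=> mf; apply: (measurableT_comp (measurable_sqnorm k)).
elim: n z F => [|n IH] z F mF F0.
  have [a [z' ->]] := tcons_tnth 0 z.
  rewrite sqnorm_cons /sqnorm [X in Num.sqrt (_ + X)]/dot big_ord0 addr0 sqrtr_sqr.
  have mFv : measurable_fun setT (fun v : 1.-tuple T => F (sqnorm 1 v, dot 1 v (tcons 0 a z'))).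
    by apply: mFpair => //; [exact: measurable_sqnorm|exact: measurable_dot].
  rewrite (ge0_integral_tupleS 0 _ mFv (fun v => F0 _)).
  transitivity (\int[mu]_x F (x ^+ 2, a * x)%R).
    apply: eq_integral => x _; rewrite ge0_integral_tuple0//; last first.
      apply: mFpair => //.
        by apply: msq; exact: measurable_tcons.
      by apply: measurable_dot => //; exact: measurable_tcons.
    by rewrite -/(sqnorm _ _) sqnorm_cons dot_cons /sqnorm /dot !big_ord0 !addr0 mulrC.
  transitivity (\int[mu]_x F (x ^+ 2, `|a| * x)%R).
    have [a0|a0] := leP 0%R a; first by rewrite ger0_norm.
    rewrite -[LHS]ge0_integralN//; last by apply: mFpair => //; meas.
    by apply: eq_integral => x _; rewrite sqrrN ltr0_norm// mulrN mulNr.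
  apply: eq_integral => x _; rewrite ge0_integral_tuple0//; last first.
    by apply: mFpair => //; apply: measurable_funD => //; exact: measurable_sqnorm.
  by rewrite /dot big_ord0 addr0.
have [a [z' ->]] := tcons_tnth n.+1 z.
have mFv : measurable_fun setT (fun v => F (sqnorm n.+2 v, dot n.+2 v (tcons n.+1 a z'))).
  by apply: mFpair => //; [exact: measurable_sqnorm|exact: measurable_dot].
rewrite (ge0_integral_tupleS n.+1 _ mFv (fun v => F0 _)).
set b := Num.sqrt (sqnorm n.+1 z').
(* Integrating out the coordinates orthogonal to the plane leaves a function to which the planar
   case applies. *)
pose Psi (p : T * T) := \int[leb n]_w F (p.1 + sqnorm n w, p.2)%R.
have mFP : measurable_fun setT (fun z : (T * T) * n.-tuple T => F (z.1.1 + sqnorm n z.2, z.1.2)%R).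
  apply: mFpair => //.
    apply: measurable_funD; last by apply: msq.
    exact: (measurableT_comp measurable_fst).
  exact: (measurableT_comp measurable_snd).
have mPsi : measurable_fun setT Psi.
  exact: (measurable_fun_fubini_tonelli_F (fun z : (T * T) * n.-tuple T => F (z.1.1 + sqnorm n
      z.2, z.1.2)%R)).
have Psi0 p : 0 <= Psi p by exact: integral_ge0.
transitivity (\int[mu]_x \int[mu]_y Psi (x ^+ 2 + y ^+ 2, a * x + b * y)%R).
  apply: eq_integral => x _.
  pose G (p : T * T) := F (x ^+ 2 + p.1, a * x + p.2)%R.
  have mG : measurable_fun setT G by apply: mFpair => //; meas.
  transitivity (\int[leb n.+1]_v G (sqnorm n.+1 v, dot n.+1 v z')).
    by apply: eq_integral => v _; rewrite sqnorm_cons dot_cons mulrC.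
  apply: (etrans (IH z' G mG (fun p => F0 _))).
  by apply: eq_integral => y _; apply: eq_integral => w _; rewrite /G/= addrA.
rewrite planar_rotation//.
apply: eq_integral => x _.
pose rho := Num.sqrt (sqnorm n.+2 (tcons n.+1 a z')).
have mFw : measurable_fun setT (fun w => F (x ^+ 2 + sqnorm n.+1 w, rho * x)%R).
  by apply: mFpair => //; apply: measurable_funD => //; exact: measurable_sqnorm.
rewrite (ge0_integral_tupleS n _ mFw (fun v => F0 _)) /rho.
apply: eq_integral => y _; apply: eq_integral => w _.
by rewrite !sqnorm_cons addrA sqr_sqrtr// sqnorm_ge0.
Qed.

End tuple_integrals.

(** * The energy of a ball *)

Section ball_energy.
Context {R : realType}.
Local Notation mu := (@lebesgue_measure R).
Local Notation T := (measurableTypeR R).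
Local Notation leb n := (@lebesgue_tuple R n).
Implicit Types (c : R).

Definition dist2 n (x y : n.-tuple T) : R := \sum_(i < n) (tnth x i - tnth y i) ^+ 2.

Lemma dist2_tadd n (x z : n.-tuple T) : dist2 n x (tadd n z x) = sqnorm n z.
Proof.
by apply: eq_bigr => i _; rewrite tnth_mktuple opprD addrCA subrr addr0 sqrrN expr2.
Qed.

Lemma measurable_dist2 n d (U : measurableType d) (f g : U -> n.-tuple T) :
  measurable_fun setT f -> measurable_fun setT g ->
  measurable_fun setT (fun x => dist2 n (f x) (g x)).
Proof.
move=> mf mg; apply: measurable_sum => i; apply: measurable_funX.
by apply: measurable_funB; [exact: (measurableT_comp (@measurable_tnth _ T n i) mf)|exact:
    (measurableT_comp (@measurable_tnth _ T n i) mg)].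
Qed.

Lemma pker1_min c1 c2 (q : R) :
  pker 1 (c1 - q) * pker 1 (c2 - q) = pker 1 (Num.min c1 c2 - q) :> R.
Proof.
rewrite !pker1 !subr_gt0 lt_min.
by case: (q < c1)%R; case: (q < c2)%R; rewrite /= ?mulr1 ?mulr0.
Qed.

Lemma dotC n (v w : n.-tuple T) : dot n v w = dot n w v.
Proof. by apply: eq_bigr => i _; rewrite mulrC. Qed.

Local Open Scope ereal_scope.

(* After the translation by rho / 2 the minimum is c - (|x| + rho / 2)^2. *)
Lemma integral_pker_lens a (rho c : R) : (0 <= rho)%R ->
  \int[mu]_x (pker a (Num.min (c - x ^+ 2) (c - (x + rho) ^+ 2)))%:E =
  2%:E * \int[mu]_y ((pker a (c - y ^+ 2))%:E * (pker 1 (y - rho / 2))%:E).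
Proof.
move=> rho0.
pose G (x : T) : \bar R := (pker a (c - (x + rho / 2) ^+ 2))%:E.
have mG : measurable_fun setT G by rewrite /G; meas.
have G0 x : 0 <= G x by rewrite lee_fin pker_ge0.
have mmin : measurable_fun setT (fun x : T => (pker a (Num.min (c - x ^+ 2) (c - (x + rho) ^+
    2)))%:E).
  apply/measurable_EFinP; apply: (measurableT_comp (measurable_pker a)).
  by apply: measurable_minr; meas.
rewrite -[LHS](ge0_integral_shift (- (rho / 2)))//; last first.
  by move=> x; rewrite lee_fin pker_ge0.
transitivity (\int[mu]_x G `|x|%R).
  apply: eq_integral => x _; rewrite /G; congr (pker _ _)%:E.
  have [x0|x0] := leP 0%R x.
    rewrite (ger0_norm x0) (_ : x - rho / 2 + rho = x + rho / 2)%R; last by field.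
    apply/min_idPr; rewrite lerD2l lerN2 -subr_ge0.
    rewrite (_ : _ - _ = 2 * (x * rho))%R; last by field.
    by rewrite !mulr_ge0.
  rewrite (ltr0_norm x0) (_ : x - rho / 2 + rho = x + rho / 2)%R; last by field.
  rewrite (_ : (- x + rho / 2) ^+ 2 = (x - rho / 2) ^+ 2)%R; last by field.
  apply/min_idPl; rewrite lerD2l lerN2 -subr_ge0.
  rewrite (_ : _ - _ = 2 * (- x * rho))%R; last by field.
  by rewrite !mulr_ge0// oppr_ge0 ltW.
rewrite (ge0_integral_even G mG G0); congr (_ * _).
rewrite -[RHS](ge0_integral_shift (rho / 2)); last 2 first.
- by meas.
- by move=> x; rewrite mule_ge0// lee_fin pker_ge0.
by apply: eq_integral => x _; rewrite /G addrK.
Qed.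

(* The volume of the intersection of two balls of squared radius c in dimension
   n + 1 whose centres are at squared distance q. *)
Definition lens n (c q : R) : \bar R :=
  (2 * ball_const n)%:E * \int[mu]_y ((pker (n%:R / 2 + 1)%R (c - y ^+ 2))%:E *
    (pker 1 (y - Num.sqrt q / 2))%:E).

(** After rotating z onto the first axis, the slice at first coordinate x is the intersection of two
    concentric n-balls of squared radii c - x^2 and c - (x + rho)^2, that is, the smaller one. *)
Lemma integral_lens n c (z : n.+1.-tuple T) :
  \int[leb n.+1]_x ((pker 1 (c - sqnorm n.+1 x))%:E *
                     (pker 1 (c - sqnorm n.+1 (tadd n.+1 z x)))%:E) =
  lens n c (sqnorm n.+1 z).
Proof.
set rho := Num.sqrt (sqnorm n.+1 z).
have rho0 : (0 <= rho)%R by exact: sqrtr_ge0.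
have rho2 : (sqnorm n.+1 z = rho ^+ 2)%R by rewrite sqr_sqrtr// sqnorm_ge0.
pose F (p : T * T) : \bar R := (pker 1 (c - p.1))%:E *
  (pker 1 (c - (rho ^+ 2 + p.2 *+ 2 + p.1)))%:E.
have mF : measurable_fun setT F.
  rewrite (_ : F = (fun p : T * T => (pker 1 (c - p.1))%:E *
    (pker 1 (c - (rho ^+ 2 + (p.2 + p.2) + p.1)))%:E)); first by meas.
  by apply/funext => p; rewrite /F mulr2n.
have F0 p : 0 <= F p by rewrite /F mule_ge0// lee_fin pker_ge0.
transitivity (\int[leb n.+1]_x F (sqnorm n.+1 x, dot n.+1 x z)).
  apply: eq_integral => x _; rewrite /F/= sqnorm_add rho2 dotC.
  by rewrite mulr2n mulrDl mul1r.
rewrite rotation// -/rho.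
transitivity (\int[mu]_x (ball_const n * pker (n%:R / 2 + 1) (Num.min (c - x ^+ 2) (c - (x +
    rho) ^+ 2)))%:E).
  apply: eq_integral => x _; rewrite -integral_ball.
  apply: eq_integral => w _; rewrite /F/= -EFinM; congr EFin.
  rewrite -pker1_min; congr (pker _ _ * pker _ _)%R; first by ring.
  by rewrite mulr2n; ring.
under eq_integral do rewrite EFinM.
rewrite ge0_integralZl_EFin//; last 3 first.
- by move=> x _; rewrite lee_fin pker_ge0.
- apply/measurable_EFinP; apply: (measurableT_comp (measurable_pker _)).
  by apply: measurable_minr; meas.
- exact: ball_const_ge0.
by rewrite integral_pker_lens// muleA -EFinM /lens mulrC.
Qed.

(** For y > 0 the indicator says t < (2 y)^2, so this is the integral of a power up to (2 y)^2. *)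
Lemma integral_pker_sqrt (s y : R) : (0 < s)%R ->
  \int[mu]_t ((pker 1 (y - Num.sqrt t / 2))%:E * (pker (s / 2) t)%:E) =
  (2 `^ s * (2 / s) * pker (s + 1) y)%:E.
Proof.
move=> s0; have s20 : (0 < s / 2)%R by rewrite divr_gt0.
have [y0|y0] := ltP 0%R y; last first.
  rewrite [pker (s + 1) y]/pker ltNge y0 mulr0 integral0_eq// => t _.
  have ty : (y <= Num.sqrt t / 2)%R by rewrite (le_trans y0)// divr_ge0// sqrtr_ge0.
  by rewrite pker1 subr_gt0 ltNge ty /= mul0e.
transitivity (\int[mu]_t ((pker 1 ((2 * y) ^+ 2 - t))%:E * (pker (s / 2) t)%:E)).
  apply: eq_integral => t _; have [t0|t0] := ltP 0%R t; last first.
    by rewrite [pker (s / 2) t]/pker ltNge t0 !mule0.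
  congr (_%:E * _); rewrite !pker1 !subr_gt0; congr (nat_of_bool _)%:R.
  rewrite ltr_pdivrMr// -[in RHS](sqr_sqrtr (ltW t0)) mulrC.
  by rewrite ltr_sqr ?nnegrE ?sqrtr_ge0// mulr_ge0// ltW.
rewrite integral_pker_pker betaEa1// -EFinM; congr EFin.
rewrite /pker y0 exprn_gt0 ?mulr_gt0// -powR_mulrn ?mulr_ge0 ?ltW// -powRrM.
rewrite !addrK mulrCA divff// mulr1 powRM ?ltW// invf_div.
by rewrite mulrAC.
Qed.

(** The value is kept as the integrations produce it: polar coordinates in z = y - x, volume of the
    slices, integral over |z|^2, and a factor 1/2 from squaring the slice coordinate before the Beta
    integral. *)
Lemma ball_energy n (s c : R) : (0 < s)%R ->
  \int[leb n.+1]_x \int[leb n.+1]_y ((pker 1 (c - sqnorm n.+1 x))%:E *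
    (pker 1 (c - sqnorm n.+1 y))%:E * (pker (1 - (n.+1%:R - s) / 2) (dist2 n.+1 x y))%:E) =
  (polar_const n.+1)%:E * ((2 * ball_const n)%:E * ((2 `^ s * (2 / s))%:E * (2^-1%:E *
   ((pker ((s + 1) / 2 + (n%:R / 2 + 1)) c)%:E * betaE ((s + 1) / 2) (n%:R / 2 + 1))))).
Proof.
move=> s0.
(* [pker a q] is q^(-(d-s)/2) with d = n + 1: the Riesz kernel in terms of the squared distance
   q. *)
set a : R := (1 - (n.+1%:R - s) / 2)%R.
have msq d (U : measurableType d) (f : U -> n.+1.-tuple T) :
    measurable_fun setT f -> measurable_fun setT (fun x => sqnorm n.+1 (f x) : T).
  by move=> mf; apply: (measurableT_comp (measurable_sqnorm n.+1)).
have mp b d (U : measurableType d) (f : U -> T) :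
    measurable_fun setT f -> measurable_fun setT (fun x => (pker b (f x))%:E).
  by move=> mf; apply/measurable_EFinP; exact: (measurableT_comp (measurable_pker b)).
pose G (p : n.+1.-tuple T * n.+1.-tuple T) : \bar R :=
  (pker 1 (c - sqnorm n.+1 p.1))%:E * (pker 1 (c - sqnorm n.+1 (tadd n.+1 p.2 p.1)))%:E *
  (pker a (sqnorm n.+1 p.2))%:E.
have mG : measurable_fun setT G.
  apply: emeasurable_funM; first apply: emeasurable_funM.
  - apply: mp; apply: measurable_funB => //; exact: msq.
  - by apply: mp; apply: measurable_funB => //; apply: msq; exact: measurable_tadd.
  - by apply: mp; exact: msq.
have G0 p : 0 <= G p by rewrite /G !mule_ge0// lee_fin pker_ge0.
transitivity (\int[leb n.+1]_x \int[leb n.+1]_z G (x, z)).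
  apply: eq_integral => x _.
  pose K (y : n.+1.-tuple T) : \bar R := (pker 1 (c - sqnorm n.+1 x))%:E *
    (pker 1 (c - sqnorm n.+1 y))%:E * (pker a (dist2 n.+1 x y))%:E.
  have mK : measurable_fun setT K.
    apply: emeasurable_funM; first apply: emeasurable_funM => //.
      by apply: mp; apply: measurable_funB => //; exact: msq.
    by apply: mp; exact: measurable_dist2.
  have K0 y : 0 <= K y by rewrite /K !mule_ge0// lee_fin pker_ge0.
  rewrite -[LHS](ge0_integral_tadd n.+1 x K mK K0).
  by apply: eq_integral => z _; rewrite /K /G dist2_tadd.
rewrite (fubini_tonelli G mG G0).
have msqrt : measurable_fun setT (Num.sqrt : T -> T).
  by apply: continuous_measurable_fun; exact: sqrt_continuous.
have mrt d (U : measurableType d) (f : U -> T) :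
    measurable_fun setT f -> measurable_fun setT (fun x => Num.sqrt (f x) : T).
  by move=> mf; exact: (measurableT_comp msqrt).
have ml : measurable_fun setT (lens n c).
  apply: emeasurable_funM => //.
  pose H (p : T * T) : \bar R := (pker (n%:R / 2 + 1)%R (c - p.2 ^+ 2))%:E *
    (pker 1 (p.2 - Num.sqrt p.1 / 2))%:E.
  apply: (measurable_fun_fubini_tonelli_F H); last first.
    by move=> p; rewrite /H mule_ge0// lee_fin pker_ge0.
  apply: emeasurable_funM; apply: mp; first by meas.
  apply: measurable_funB => //; apply: measurable_funM => //; apply: mrt; exact: measurable_fst.
have l0 q : 0 <= lens n c q.
  apply: mule_ge0; first by rewrite lee_fin mulr_ge0// ball_const_ge0.
  by apply: integral_ge0 => y _; rewrite mule_ge0// lee_fin pker_ge0.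
transitivity (\int[leb n.+1]_z (lens n c (sqnorm n.+1 z) * (pker a (sqnorm n.+1 z))%:E)).
  apply: eq_integral => z _; rewrite /G -integral_lens.
  pose A (x : n.+1.-tuple T) : \bar R := (pker 1 (c - sqnorm n.+1 x))%:E *
    (pker 1 (c - sqnorm n.+1 (tadd n.+1 z x)))%:E.
  have mA : measurable_fun setT A.
    apply: emeasurable_funM; apply: mp; apply: measurable_funB => //; first exact: msq.
    by apply: msq; exact: measurable_tadd.
  have A0 x : setT x -> 0 <= A x by move=> _; rewrite /A mule_ge0// lee_fin pker_ge0.
  have k0 : 0 <= (pker a (sqnorm n.+1 z))%:E by rewrite lee_fin pker_ge0.
  exact: (ge0_integralZr (leb n.+1) measurableT mA A0 k0).
rewrite (integral_polar n (fun q => lens n c q * (pker a q)%:E)); last 2 first.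
- by apply: emeasurable_funM => //; exact: mp.
- by move=> x; rewrite mule_ge0// lee_fin pker_ge0.
congr (_ * _).
pose H (p : T * T) : \bar R := (pker (n%:R / 2 + 1)%R (c - p.2 ^+ 2))%:E *
  ((pker 1 (p.2 - Num.sqrt p.1 / 2))%:E * (pker (s / 2) p.1)%:E).
have mH : measurable_fun setT H.
  apply: emeasurable_funM; first by apply: mp; meas.
  apply: emeasurable_funM; apply: mp => //.
  by apply: measurable_funB => //; apply: measurable_funM => //; apply: mrt; exact: measurable_fst.
have H0 p : 0 <= H p by rewrite /H !mule_ge0// lee_fin pker_ge0.
transitivity ((2 * ball_const n)%:E * \int[mu]_t \int[mu]_y H (t, y)).
  rewrite -ge0_integralZl_EFin//; last 3 first.
  - by move=> t _; exact: integral_ge0.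
  - exact: (measurable_fun_fubini_tonelli_F H).
  - by rewrite mulr_ge0// ball_const_ge0.
  apply: eq_integral => t _; rewrite /lens -!muleA; congr (_ * _).
  (* The dimension cancels between the Riesz kernel and the polar density, leaving t^(s/2-1),
     integrable at 0 as s > 0. *)
  have -> : (pker a t)%:E * (pker (n.+1%:R / 2)%R t)%:E = (pker (s / 2)%R t)%:E.
    rewrite -EFinM; congr EFin; rewrite /pker; case: ifPn => t0; last by rewrite mulr0.
    rewrite -powRD; last by rewrite (gt_eqF t0) implybT.
    by congr (_ `^ _)%R; rewrite /a; field.
  rewrite -ge0_integralZr//; last 3 first.
  - apply: emeasurable_funM; apply: mp; first by meas.
    by apply: measurable_funB.
  - by move=> y _; rewrite mule_ge0// lee_fin pker_ge0.
  - by rewrite lee_fin pker_ge0.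
  by apply: eq_integral => y _; rewrite /H muleA.
(* The lens volume is an incomplete Beta integral; integrating over t before the slice coordinate y
   avoids evaluating it. *)
congr (_ * _); rewrite (fubini_tonelli H mH H0).
transitivity ((2 `^ s * (2 / s))%:E * \int[mu]_y ((pker (n%:R / 2 + 1)%R (c - y `^ 2))%:E *
    (pker (s + 1) y)%:E)).
  rewrite -ge0_integralZl_EFin//; last 3 first.
  - by move=> y _; rewrite mule_ge0// lee_fin pker_ge0.
  - by meas.
  - by rewrite mulr_ge0 ?powR_ge0// divr_ge0// ltW.
  apply: eq_integral => y _; rewrite /H/= ge0_integralZl//; last 3 first.
  - apply: emeasurable_funM; apply: mp => //.
    by apply: measurable_funB => //; apply: measurable_funM.
  - by move=> t _; rewrite mule_ge0// lee_fin pker_ge0.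
  - by rewrite lee_fin pker_ge0.
  rewrite integral_pker_sqrt// [in RHS]muleCA -EFinM.
  have [y0|y0] := ltP 0%R y; last by rewrite [pker (s + 1) y]/pker ltNge y0 !(mulr0, mule0).
  by rewrite powR_mulrn// ltW.
congr (_ * _).
rewrite (mellin_powR 2 (s + 1) (fun q => (pker (n%:R / 2 + 1)%R (c - q))%:E))//; last 2 first.
- by meas.
- by move=> x; rewrite lee_fin pker_ge0.
by rewrite ger0_norm// integral_pker_pker.
Qed.

End ball_energy.

(** * Volumes and Riesz energies of balls *)

Section assembly.
Context {R : realType}.
Local Notation mu := (@lebesgue_measure R).
Local Notation T := (measurableTypeR R).
Local Notation leb n := (@lebesgue_tuple R n).

Lemma Gamma_neq0 (a : R) : 0 < a -> Gamma a != 0.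
Proof. by move=> a0; apply: lt0r_neq0; exact: Gamma_gt0. Qed.

Lemma sqrt_pi_neq0 : Num.sqrt pi != 0 :> R.
Proof. by rewrite gt_eqF// sqrtr_gt0 pi_gt0. Qed.

Lemma powR_half_nat (n : nat) : pi `^ (n%:R / 2) = Num.sqrt pi ^+ n :> R.
Proof.
by rewrite mulrC powRrM powR12_sqrt ?pi_ge0// powR_mulrn.
Qed.

Lemma sphere_areaE n : sphere_area n = n%:R * ball_const n :> R.
Proof. by rewrite /sphere_area powR_half_nat mulrA. Qed.

Lemma ball_const_gt0 n : 0 < ball_const n :> R.
Proof.
apply: divr_gt0; first by rewrite exprn_gt0// sqrtr_gt0 pi_gt0.
by apply: Gamma_gt0; rewrite ltr_wpDl// divr_ge0.
Qed.

Lemma dist2_origin n (v : n.-tuple T) : dist2 n (origin n) v = sqnorm n v.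
Proof. by apply: eq_bigr => i _; rewrite tnth_mktuple sub0r sqrrN expr2. Qed.

Lemma eballE n (r : R) : 0 < r ->
  eball (origin n) r = [set v : n.-tuple T | sqnorm n v < r ^+ 2].
Proof.
move=> r0; apply/seteqP; split => v; rewrite /eball/=.
  rewrite (_ : Defs.edist _ _ = Num.sqrt (sqnorm n v)); last by rewrite -dist2_origin.
  rewrite -[X in X < _ ^+ _](sqr_sqrtr (sqnorm_ge0 n v)).
  by rewrite ltr_sqr ?nnegrE ?sqrtr_ge0// ltW.
rewrite (_ : Defs.edist _ _ = Num.sqrt (sqnorm n v)); last by rewrite -dist2_origin.
rewrite -[X in X < _ ^+ _](sqr_sqrtr (sqnorm_ge0 n v)).
by rewrite ltr_sqr ?nnegrE ?sqrtr_ge0// ltW.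
Qed.

Lemma in_eball n (r : R) (v : n.-tuple T) : 0 < r ->
  (v \in (eball (origin n) r : set (n.-tuple T)))%:R = pker 1 (r ^+ 2 - sqnorm n v) :> R.
Proof.
move=> r0; rewrite pker1 subr_gt0 eballE//; congr (nat_of_bool _)%:R.
by apply/idP/idP; rewrite inE.
Qed.

Lemma measurable_eball n (r : R) : 0 < r ->
  measurable (eball (origin n) r : set (n.-tuple T)).
Proof.
move=> r0; rewrite eballE//.
rewrite (_ : mkset _ = (@sqnorm R n) @^-1` `]-oo, r ^+ 2[%classic); last first.
  by apply/seteqP; split => v /=; rewrite in_itv.
by rewrite -[X in measurable X]setTI; apply: measurable_sqnorm.
Qed.

Lemma lebesgue_eball n (r : R) : 0 < r ->
  leb n (eball (origin n) r) = (ball_const n * r ^+ n)%:E.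
Proof.
move=> r0; have mD := measurable_eball n r r0.
transitivity (\int[leb n]_v (pker 1 (r ^+ 2 - sqnorm n v))%:E)%E.
  rewrite -[LHS]mul1e -(@integral_cst _ _ _ (leb n) _ mD 1%E).
  rewrite integral_mkcond; apply: eq_integral => v _.
  by rewrite patchE -in_eball//; case: ifP.
rewrite integral_ball; congr (_ * _)%:E.
rewrite /pker exprn_gt0// addrK -powR_mulrn ?ltW// -powRrM mulrCA divff// mulr1.
by rewrite powR_mulrn// ltW.
Qed.

(* On the diagonal both sides are 0, the left one because 1 / 0 = 0. *)
Lemma riesz_kernelE n (t : R) (x y : n.-tuple T) : 0 < t ->
  1 / Defs.edist x y `^ t = pker (1 - t / 2) (dist2 n x y).
Proof.
move=> t0; rewrite /Defs.edist -/(dist2 n x y).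
have q0 : 0 <= dist2 n x y by apply: sumr_ge0 => i _; exact: sqr_ge0.
move: (dist2 n x y) q0 => q; rewrite le_eqVlt => /orP[/eqP <-|q0].
  by rewrite /pker ltxx sqrtr0 powR0 ?gt_eqF// invr0 mulr0.
rewrite /pker q0 div1r -powR12_sqrt ?ltW// -powRrM -powRN.
by congr (_ `^ _); field.
Qed.

(** The covolume appears squared because both measures are scaled by it. Gamma(n/2+1) cancels
    between the slice volume and the Beta integral. *)
Lemma riesz_energy_ball n (L : set (n.+1.-tuple R)) (r s : R) :
  0 < r -> 0 < s -> s < n.+1%:R ->
  riesz_energy (lattice_measure L) (eball (origin n.+1) r) (n.+1%:R - s) =
  (`|covolume L| ^+ 2 * (Num.sqrt pi ^+ (n.+1 + n) / Gamma (n.+1%:R / 2) *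
    (2 `^ s * (2 / s)) * Gamma ((s + 1) / 2) / Gamma ((n.+1%:R + s) / 2 + 1) *
    r `^ (n.+1%:R + s)))%:E.
Proof.
move=> r0 s0 sd.
pose D : set (n.+1.-tuple T) := eball (origin n.+1) r.
pose G (p : n.+1.-tuple T * n.+1.-tuple T) : \bar R :=
  ((pker 1 (r ^+ 2 - sqnorm n.+1 p.1))%:E * (pker 1 (r ^+ 2 - sqnorm n.+1 p.2))%:E *
  (pker (1 - (n.+1%:R - s) / 2) (dist2 n.+1 p.1 p.2))%:E)%E.
have G0 p : (0 <= G p)%E by rewrite /G !mule_ge0// lee_fin pker_ge0.
have mp b d (U : measurableType d) (f : U -> T) :
    measurable_fun setT f -> measurable_fun setT (fun x => (pker b (f x))%:E).
  by move=> mf; apply/measurable_EFinP; exact: (measurableT_comp (measurable_pker b)).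
have msq d (U : measurableType d) (f : U -> n.+1.-tuple T) :
    measurable_fun setT f -> measurable_fun setT (fun x => sqnorm n.+1 (f x) : T).
  by move=> mf; apply: (measurableT_comp (measurable_sqnorm n.+1)).
have mG : measurable_fun setT G.
  apply: emeasurable_funM; first apply: emeasurable_funM.
  - by apply: mp; apply: measurable_funB => //; exact: msq.
  - by apply: mp; apply: measurable_funB => //; exact: msq.
  - by apply: mp; exact: measurable_dist2.
pose nu := lattice_measure L.
transitivity (\int[nu \x nu]_z G z)%E.
  rewrite /riesz_energy integral_mkcond; apply: eq_integral => -[x y] _.
  rewrite patchE /G/= -!in_eball//.
  rewrite in_setX/=; case: (x \in _); case: (y \in _); rewrite /= ?mul0e ?mul1e ?mule0 ?mul0e//.
  congr EFin; by apply: riesz_kernelE; rewrite subr_gt0.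
have nuE (F : n.+1.-tuple T -> \bar R) : measurable_fun setT F -> (forall x, 0 <= F x)%E ->
    (\int[nu]_x F x = (`|covolume L|)%:E * \int[leb n.+1]_x F x)%E.
  move=> mF F0.
  exact: (@ge0_integral_mscale _ _ R (leb n.+1) setT measurableT (`|covolume L|%:nng)%R F mF
      (fun x _ => F0 x)).
have mGx x : measurable_fun setT (fun y => G (x, y)).
  by apply: (measurableT_comp mG); exact: measurable_fun_pair.
have mGi : measurable_fun setT (fun x => \int[leb n.+1]_y G (x, y))%E.
  exact: (measurable_fun_fubini_tonelli_F G mG G0).
have Gi0 x : (0 <= \int[leb n.+1]_y G (x, y))%E by exact: integral_ge0.
transitivity (\int[nu]_x \int[nu]_y G (x, y))%E.
  exact: (fubini_tonelli1 G mG G0).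
transitivity (\int[nu]_x (`|covolume L|%:E * \int[leb n.+1]_y G (x, y)))%E.
  by apply: eq_integral => x _; exact: nuE.
rewrite nuE; last 2 first.
- exact: emeasurable_funM.
- by move=> x; apply: mule_ge0.
have n0 : (0 <= `|covolume L|)%R by [].
rewrite (ge0_integralZl_EFin (leb n.+1) measurableT (fun x _ => Gi0 x) mGi n0).
rewrite [X in (_ * (_ * X))%E](ball_energy n s (r ^+ 2) s0).
have s10 : 0 < (s + 1) / 2 by rewrite divr_gt0// addr_gt0.
have n10 : 0 < n%:R / 2 + 1 :> R by rewrite ltr_wpDl// divr_ge0.
rewrite (betaE_Gamma _ _ s10 n10) -!EFinM; congr EFin.
have -> : (s + 1) / 2 + (n%:R / 2 + 1) = (n.+1%:R + s) / 2 + 1.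
  by rewrite -natr1; field.
have -> : pker ((n.+1%:R + s) / 2 + 1) (r ^+ 2) = r `^ (n.+1%:R + s).
  rewrite /pker exprn_gt0// addrK -powR_mulrn ?ltW// -powRrM mulrCA divff//.
  by rewrite mulr1.
rewrite /polar_const /ball_const exprD.
have P1 := Gamma_neq0 _ s10.
have P2 := Gamma_neq0 _ n10.
have P3 : Gamma (n.+1%:R / 2 : R) != 0 by apply: Gamma_neq0; rewrite divr_gt0.
have P4 : Gamma ((n.+1%:R + s) / 2 + 1) != 0.
  by apply: Gamma_neq0; rewrite addr_gt0// divr_gt0// addr_gt0.
have P5 := lt0r_neq0 s0.
move: P1 P2 P3 P4 P5.
generalize (Num.sqrt (pi : R) ^+ n.+1) (Num.sqrt (pi : R) ^+ n) (`|covolume L|).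
field_gamma.
Qed.

(** The parameters satisfy c = 2 b, so Gamma(c-b) = Gamma(b) cancels against a factor of Gamma(c)
    expanded by the duplication formula. *)
Lemma bessel_integral_hyp2F1 (d : nat) (s : R) : 0 < s -> s < d%:R ->
  Gamma ((d%:R - s) / 2) * Gamma ((s + 1) / 2) /
   (2 * Num.sqrt pi * Gamma (s / 2 + 1) * Gamma ((d%:R + s) / 2 + 1)) =
  Gamma ((d%:R - s) / 2) / (2 ^+ d.+1 * Gamma (d%:R / 2 + 1) * Gamma (s / 2 + 1))
    * hyp2F1 ((d%:R - s) / 2) ((d%:R + 1) / 2) (d%:R + 1) 1.
Proof.
move=> s0 sd; have d0 : 0 < d%:R :> R by exact: lt_trans sd.
have a0 : 0 < (d%:R - s) / 2 by rewrite divr_gt0// subr_gt0.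
have b0 : 0 < (d%:R + 1) / 2 :> R by rewrite divr_gt0// addr_gt0.
have abc : (d%:R - s) / 2 + (d%:R + 1) / 2 < d%:R + 1 by lra.
rewrite hyp2F1_gauss// Gamma_duplication_nat.
rewrite (_ : d%:R + 1 - (d%:R - s) / 2 - (d%:R + 1) / 2 = (s + 1) / 2); last by field.
rewrite (_ : d%:R + 1 - (d%:R - s) / 2 = (d%:R + s) / 2 + 1); last by field.
rewrite (_ : d%:R + 1 - (d%:R + 1) / 2 = (d%:R + 1) / 2); last by field.
have P1 := Gamma_neq0 _ b0.
have P2 : Gamma (d%:R / 2 + 1 : R) != 0 by apply: Gamma_neq0; rewrite addr_gt0// divr_gt0.
have P3 : Gamma (s / 2 + 1) != 0 by apply: Gamma_neq0; rewrite addr_gt0// divr_gt0.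
have P4 : Gamma ((d%:R + s) / 2 + 1) != 0.
  by apply: Gamma_neq0; rewrite addr_gt0// divr_gt0// addr_gt0.
have P5 := sqrt_pi_neq0.
by rewrite exprS; move: P1 P2 P3 P4 P5; field_gamma.
Qed.

Lemma bessel_integral_Gamma (d : nat) (s : R) : 0 < s -> s < d%:R ->
  Gamma ((d%:R - s) / 2) * Gamma ((s + 1) / 2) /
   (2 * Num.sqrt pi * Gamma (s / 2 + 1) * Gamma ((d%:R + s) / 2 + 1)) =
  Gamma ((d%:R - s) / 2) * Gamma (d%:R + 1) * Gamma ((s + 1) / 2)
    / (2 ^+ d.+1 * Gamma (d%:R / 2 + 1) * Gamma (s / 2 + 1)
       * Gamma ((d%:R + s) / 2 + 1) * Gamma ((d%:R + 1) / 2)).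
Proof.
move=> s0 sd; have d0 : 0 < d%:R :> R by exact: lt_trans sd.
rewrite Gamma_duplication_nat.
have P1 : Gamma ((d%:R + 1) / 2 : R) != 0 by apply: Gamma_neq0; rewrite divr_gt0// addr_gt0.
have P2 : Gamma (d%:R / 2 + 1 : R) != 0 by apply: Gamma_neq0; rewrite addr_gt0// divr_gt0.
have P3 : Gamma (s / 2 + 1) != 0 by apply: Gamma_neq0; rewrite addr_gt0// divr_gt0.
have P4 : Gamma ((d%:R + s) / 2 + 1) != 0.
  by apply: Gamma_neq0; rewrite addr_gt0// divr_gt0// addr_gt0.
have P5 := sqrt_pi_neq0.
by rewrite exprS; move: P1 P2 P3 P4 P5; field_gamma.
Qed.

(** Since r is q vol^(-1/d) with q the radius at covolume 1, r^(d+s) contributes vol^(-1-s/d). With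
    vol^2 from the energy this cancels vol^(1-s/d), so the covolume disappears. *)
Lemma riesz_bessel_constants n (s vol : R) : 0 < s -> s < n.+1%:R -> 0 < vol ->
  let d : R := n.+1%:R in
  let omega := sphere_area n.+1 in
  let r := (d * vol^-1 / omega) `^ d^-1 in
  (pi `^ (s - d / 2) * Gamma ((d - s) / 2) / (Gamma (s / 2) * vol `^ (1 - s / d))) *
  (vol ^+ 2 * (Num.sqrt pi ^+ (n.+1 + n) / Gamma (d / 2) *
    (2 `^ s * (2 / s)) * Gamma ((s + 1) / 2) / Gamma ((d + s) / 2 + 1) *
    r `^ (d + s))) =
  (d * (2 * pi * (d / omega) `^ d^-1) `^ s) *
  (Gamma ((d - s) / 2) * Gamma ((s + 1) / 2) /
   (2 * Num.sqrt pi * Gamma (s / 2 + 1) * Gamma ((d + s) / 2 + 1))).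
Proof.
move=> s0 sd vol0 d omega r.
have d0 : 0 < d by [].
have d20 : 0 < d / 2 by rewrite divr_gt0.
have s20 : 0 < s / 2 by rewrite divr_gt0.
have om0 : 0 < omega by rewrite /omega sphere_areaE mulr_gt0// ball_const_gt0.
have omE : omega = d * (Num.sqrt pi ^+ n.+1 / Gamma (d / 2 + 1)) by rewrite /omega sphere_areaE.
have dom0 : 0 < d / omega by rewrite divr_gt0.
have vi0 : 0 <= vol^-1 by rewrite invr_ge0 ltW.
pose q := (d / omega) `^ d^-1.
have q0 : 0 < q by exact: powR_gt0.
have nz (x : R) : 0 < x -> forall e1 e2 : R, (e1 + e2 == 0) ==> (x != 0).
  by move=> x0 e1 e2; rewrite (gt_eqF x0) implybT.
have rE : r `^ (d + s) = (d / omega) * q `^ s * vol^-1 * vol `^ (- (s / d)).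
  have -> : r = q * vol `^ (- d^-1).
    rewrite /r /q mulrAC (powRM _ (ltW dom0) vi0).
    by rewrite -(powR_inv1 (ltW vol0)) -powRrM mulN1r.
  rewrite powRM ?powR_ge0//; rewrite powRD; last exact: nz.
  rewrite -(powRrM _ d^-1 d) (mulVf (lt0r_neq0 d0)) (powRr1 (ltW dom0)).
  rewrite -powRrM (_ : - d^-1 * (d + s) = -1 + - (s / d)); last by field; rewrite gt_eqF.
  by rewrite powRD ?nz// powR_inv1 ?ltW// !mulrA.
rewrite rE.
have -> : vol `^ (1 - s / d) = vol * vol `^ (- (s / d)).
  by rewrite powRD ?nz// powRr1 ?ltW.
have -> : pi `^ (s - d / 2) = pi `^ s / Num.sqrt pi ^+ n.+1.
  by rewrite powRD ?nz ?pi_gt0// powRN powR_half_nat.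
have -> : (2 * pi * (d / omega) `^ d^-1) `^ s = 2 `^ s * pi `^ s * q `^ s.
  by rewrite -/q !powRM ?mulr_ge0 ?pi_ge0// ltW.
rewrite omE (GammaS _ d20) (GammaS _ s20) exprD exprS.
have P1 := Gamma_neq0 _ d20.
have P2 := Gamma_neq0 _ s20.
have P3 : Gamma ((d + s) / 2 + 1) != 0.
  by apply: Gamma_neq0; rewrite addr_gt0// divr_gt0// addr_gt0.
have P4 := sqrt_pi_neq0.
have P5 := lt0r_neq0 s0.
have P6 := lt0r_neq0 d0.
have P7 := lt0r_neq0 vol0.
have P8 : vol `^ (- (s / d)) != 0 by rewrite gt_eqF// powR_gt0.
have P9 : Num.sqrt pi ^+ n != 0 :> R by rewrite expf_neq0.
move: P1 P2 P3 P4 P5 P6 P7 P8 P9.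
generalize (Num.sqrt (pi : R) ^+ n).
by field_gamma.
Qed.

End assembly.

Theorem proposition3 (R : realType) (d : nat) (d_ge1 : (1 <= d)%N)
    (L : set (d.-tuple R)) (hL : is_lattice L)
    (s : R) (s_gt0 : 0 < s) (s_lt_d : s < d%:R) :
  let vol := covolume L in
  let omega : R := sphere_area d in
  let r := (d%:R * vol^-1 / omega) `^ (d%:R^-1) in
  let D := eball (origin d) r in
  let bessel_integral : \bar R :=
    (\int[@lebesgue_measure R]_(t in `]0%R, +oo[)
       (besselJ (d%:R / 2) t ^+ 2 / t `^ (1 + s))%:E)%E in
  [/\ (lebesgue_tuple D * vol%:E)%E = 1%E,
      ((pi `^ (s - d%:R / 2) * Gamma ((d%:R - s) / 2)
          / (Gamma (s / 2) * vol `^ (1 - s / d%:R)))%:E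
        * riesz_energy (lattice_measure L) D (d%:R - s))%E
      = ((d%:R * (2 * pi * (d%:R / omega) `^ (d%:R^-1)) `^ s)%:E
        * bessel_integral)%E,
      bessel_integral
      = (Gamma ((d%:R - s) / 2)
          / (2 ^+ d.+1 * Gamma (d%:R / 2 + 1) * Gamma (s / 2 + 1))
          * hyp2F1 ((d%:R - s) / 2) ((d%:R + 1) / 2) (d%:R + 1) 1)%:E
    & bessel_integral
      = (Gamma ((d%:R - s) / 2) * Gamma (d%:R + 1) * Gamma ((s + 1) / 2)
          / (2 ^+ d.+1 * Gamma (d%:R / 2 + 1) * Gamma (s / 2 + 1)
             * Gamma ((d%:R + s) / 2 + 1) * Gamma ((d%:R + 1) / 2)))%:E].
Proof.
case: d d_ge1 L hL s_lt_d => // n _ L hL sd vol omega r D bessel_integral.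
have vol0 : 0 < vol by exact: covolume_gt0.
have om0 : 0 < omega by rewrite /omega sphere_areaE mulr_gt0// ball_const_gt0.
have rd0 : 0 < n.+1%:R * vol^-1 / omega by rewrite divr_gt0// mulr_gt0// invr_gt0.
have r0 : 0 < r by exact: powR_gt0.
(* The last three claims are all compared with this closed form. *)
have BE : bessel_integral = (Gamma ((n.+1%:R - s) / 2) * Gamma ((s + 1) / 2) /
    (2 * Num.sqrt pi * Gamma (s / 2 + 1) * Gamma ((n.+1%:R + s) / 2 + 1)))%:E.
  exact: bessel_integralE.
split.
- rewrite (lebesgue_eball n.+1 r r0) -EFinM /r -powR_mulrn ?powR_ge0// -powRrM.
  rewrite mulVf ?pnatr_eq0// (powRr1 (ltW rd0)).
  congr EFin; rewrite /omega sphere_areaE.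
  have alg (A B N : R) : A != 0 -> B != 0 -> N != 0 -> A * (N * B^-1 / (N * A)) * B = 1.
    by move=> *; field; nonzeros.
  by apply: alg; [exact: lt0r_neq0 (ball_const_gt0 _)|exact: lt0r_neq0|rewrite pnatr_eq0].
- rewrite (riesz_energy_ball n L r s r0 s_gt0 sd) (gtr0_norm vol0) BE -!EFinM.
  by congr EFin; exact: riesz_bessel_constants.
- by rewrite BE; congr EFin; exact: bessel_integral_hyp2F1.
- by rewrite BE; congr EFin; exact: bessel_integral_Gamma.
Qed.
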